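(* For a Finsler manifold $(M,L)$ of dimension $n$ let $p(\overline X,\overline Y):=\mathrm{Tr}\{\overline Z\mapsto P^\circ(\overline X,\overline Y)\overline Z\}$ and define the $\pi$-tensor field (the Douglas tensor) $$\mathbb P(\overline X,\overline Y)\overline Z:=P^\circ(\overline X,\overline Y)\overline Z-\frac1{n+1}\,\mathfrak S_{\overline X,\overline Y,\overline Z}\{p(\overline X,\overline Y)\,\overline Z\}-\frac1{n+1}\{(D^\circ_{\gamma\overline Y}p)(\overline X,\overline Z)\}\,\overline\eta,$$ where $\mathfrak S_{\overline X,\overline Y,\overline Z}$ denotes the cyclic sum. Then $\mathbb P$ is invariant under projective changes: if $L\to\widetilde L$ is a projective change, i.e. $\widetilde G=G-2\lambda\,\mathcal C$, then $\widetilde{\mathbb P}=\mathbb P$.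
   Context: $M$ is a real paracompact $C^\infty$ manifold of dimension $n$; $\pi:\mathcal TM\to M$ is the bundle of nonzero tangent vectors; $\pi^{-1}(TM)\to\mathcal TM$ is the pullback of $TM$ by $\pi$. Sections of $\pi^{-1}(TM)$ are called $\pi$-vector fields and written $\overline X$; tensor fields on $\pi^{-1}(TM)$ are called $\pi$-tensor fields (scalar-valued covariant ones: $\pi$-forms). $\overline\eta$ is the $\pi$-vector field $\overline\eta(u)=(u,u)$. There is an exact sequence $0\to\pi^{-1}(TM)\xrightarrow{\gamma}T(\mathcal TM)\xrightarrow{\rho}\pi^{-1}(TM)\to0$, where $\gamma$ is the vertical lift $\gamma(u,w)=\frac{d}{dt}\big|_{t=0}(u+tw)$ and $\rho$ sends $X\in T_u(\mathcal TM)$ to $(u,d\pi(X))$. Put $J:=\gamma\circ\rho$ and $\mathcal C:=\gamma\circ\overline\eta$. For a function $f$, $d_Jf(X)=(JX)\cdot f$. For a Finsler manifold $(M,L)$ with $E=\frac12L^2$: the canonical spray $G$ is the vector field with $i_G\,dd_JE=-dE$; the Barthel connection is $\Gamma=[J,G]$, i.e. $\Gamma(X)=[JX,G]-J[X,G]$; $h=\frac12(I+\Gamma)$, $v=\frac12(I-\Gamma)$. The horizontal map $\beta:\pi^{-1}(TM)\to T(\mathcal TM)$ sends $\overline X$ to the unique vector in the image of $h$ with $\rho(\beta\overline X)=\overline X$; $K:T(\mathcal TM)\to\pi^{-1}(TM)$ is determined by $\gamma\circ K=v$. The Berwald connection $D^\circ$ is the linear connection on $\pi^{-1}(TM)$ with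 $D^\circ_{\gamma\overline X}\overline Y=\rho[\gamma\overline X,\beta\overline Y]$ and $D^\circ_{\beta\overline X}\overline Y=K[\beta\overline X,\gamma\overline Y]$. Curvature: $\mathbf K(X,Y)\overline Z=-D^\circ_XD^\circ_Y\overline Z+D^\circ_YD^\circ_X\overline Z+D^\circ_{[X,Y]}\overline Z$; the $hv$-curvature is $P^\circ(\overline X,\overline Y)\overline Z=\mathbf K(\beta\overline X,\gamma\overline Y)\overline Z$. Projective change: a change $L\to\widetilde L$ of Finsler structures on $M$ whose canonical sprays satisfy $\widetilde G=G-2\lambda\mathcal C$ for a function $\lambda$ on $TM$ (smooth on $\mathcal TM$) positively homogeneous of degree 1 in $y$. Tilded objects are those of $(M,\widetilde L)$. *)

(* Defs.v *)
From HB Require Import structures.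
From mathcomp Require Import all_boot all_order all_algebra.
From mathcomp Require Import all_classical all_reals all_analysis.

Set Implicit Arguments.
Unset Strict Implicit.
Unset Printing Implicit Defensive.

Import Order.TTheory GRing.Theory Num.Theory.
Import numFieldNormedType.Exports.

Local Open Scope classical_set_scope.
Local Open Scope ring_scope.

Section SmoothMaps.
Context {R : realType} {V W : normedModType R}.

Fixpoint class_C (k : nat) (U : set V) (f : V -> W) : Prop :=
  match k with
  | 0 => forall x, U x -> {for x, continuous f}
  | k'.+1 => (forall x, U x -> differentiable f x) /\
             (forall v : V, class_C k' U (fun x => 'D_v f x))
  end.

Definition smooth_on (U : set V) (f : V -> W) : Prop :=
  forall k, class_C k U f.

End SmoothMaps.

(** [par] is the inverse of [crd]; its values outside of [crd @` dom] are
    irrelevant. *)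
Record chart (R : realType) (E : normedModType R) (T : Type) : Type := Chart {
  dom : set T;
  crd : T -> E;
  par : E -> T
}.

(** A type in which every point [x] comes with a preferred chart around [x]. *)
Record charted (R : realType) (E : normedModType R) : Type := Charted {
  point :> Type;
  chart_at : point -> chart E point
}.

Section TangentVectors.
Context {R : realType} {E : normedModType R} {N : charted E}.

(** A tangent vector at [x] is represented by its components in the preferred
    chart at [x].  The components of [v : tangent x] in another chart [c] are
    [dir v (crd c)]. *)
Definition tangent (x : N) : normedModType R := E.

Definition dir {W : normedModType R} {x : N} (v : tangent x) (f : N -> W) : W :=
  'D_(v : E) (f \o par (chart_at x)) (crd (chart_at x) x).

(** The tangent vector at [par c a] whose components in the chart [c] are
    [w]. *)
Definition tangent_par (c : chart E N) (a w : E) : tangent (par c a) :=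
  'D_w (crd (chart_at (par c a)) \o par c) a.

Definition velocity (x : N) (s : R -> N) : tangent x :=
  'D_1 (crd (chart_at x) \o s : R -> E) 0.

Definition smooth_at {W : normedModType R} (x : N) (f : N -> W) : Prop :=
  exists U : set E, [/\ open U, U (crd (chart_at x) x)
                      & smooth_on U (f \o par (chart_at x))].

Definition smooth {W : normedModType R} (f : N -> W) : Prop :=
  forall x, smooth_at x f.

Definition vfield : Type := forall x : N, tangent x.

Definition vfield_smooth_at (x : N) (X : vfield) : Prop :=
  smooth_at x (fun y => dir (X y) (crd (chart_at x))).

Definition vfield_smooth (X : vfield) : Prop :=
  forall x, vfield_smooth_at x X.

Definition act {W : normedModType R} (X : vfield) (f : N -> W) : N -> W :=
  fun x => dir (X x) f.

(** [[X, Y] . f = X . (Y . f) - Y . (X . f)], where [f] is the (vector of)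
    coordinate functions of the preferred chart. *)
Definition bracket (X Y : vfield) : vfield := fun x =>
  act X (act Y (crd (chart_at x))) x - act Y (act X (crd (chart_at x))) x.

(** The differential of a 1-form [w], given by its values on vector fields. *)
Definition ext_d (w : vfield -> N -> R) (X Y : vfield) : N -> R := fun x =>
  act X (w Y) x - act Y (w X) x - w (bracket X Y) x.

End TangentVectors.

Arguments vfield {R E} N.
Arguments smooth_at {R E} N {W} x f.
Arguments smooth {R E} N {W} f.

Definition tmap (R : realType) (E E' : normedModType R) (N : charted E)
    (N' : charted E') (f : N -> N') (x : N) (v : tangent x) : tangent (f x) :=
  dir v (crd (chart_at (f x)) \o f).

Definition locally_finite (T : topologicalType) (V : set (set T)) : Prop :=
  forall x : T, exists2 W, nbhs x W & finite_set [set A | V A /\ A `&` W !=set0].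

Definition paracompact (T : topologicalType) : Prop :=
  forall U : set (set T),
    (forall A, U A -> open A) -> \bigcup_(A in U) A = setT ->
    exists V : set (set T),
      [/\ forall A, V A -> open A, \bigcup_(A in V) A = setT,
          forall A, V A -> exists2 B, U B & A `<=` B
        & locally_finite V].

(** The smooth structure is the one of the atlas [{mchart x | x in M}]. *)
Record manifold (R : realType) (n : nat) : Type := Manifold {
  mspace : topologicalType;
  mchart : mspace -> chart 'rV[R]_n mspace;
  manifold_hausdorff : hausdorff_space mspace;
  manifold_paracompact : paracompact mspace;
  mchart_dom : forall x, open (dom (mchart x)) /\ dom (mchart x) x;
  mchart_open : forall x, open (crd (mchart x) @` dom (mchart x));
  mchart_crdK : forall x y, dom (mchart x) y -> par (mchart x) (crd (mchart x) y) = y;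
  mchart_crd_continuous : forall x, {within dom (mchart x), continuous (crd (mchart x))};
  mchart_par_continuous : forall x, {within crd (mchart x) @` dom (mchart x),
                 continuous (par (mchart x))};
  mchart_transition : forall x y,
      smooth_on (crd (mchart x) @` (dom (mchart x) `&` dom (mchart y)))
                (crd (mchart y) \o par (mchart x))
}.

Definition charted_manifold (R : realType) (n : nat) (M : manifold R n) :
  charted 'rV[R]_n := Charted (@mchart R n M).
Coercion charted_manifold : manifold >-> charted.

Section SlitTangentBundle.
Context {R : realType} {n : nat}.
Variable M : manifold R n.

(** The pair [(x, y)] stands for [y : tangent x]. *)
Definition TM : Type := (mspace M * 'rV[R]_n)%type.

Definition slitTM : Type := {u : TM | u.2 != 0}.

Definition slit_proj (u : slitTM) : M := (val u).1.

(** The chart [(x^i, y^i)] induced by the preferred chart at [slit_proj u]. *)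
Definition slit_chart (u : slitTM) : chart ('rV[R]_n * 'rV[R]_n)%type slitTM :=
  let c := chart_at (slit_proj u) in
  {| dom := [set u' | dom c (slit_proj u')];
     crd := fun u' => (crd c (slit_proj u'),
                       dir ((val u').2 : tangent (slit_proj u')) (crd c));
     par := fun a => insubd u (par c a.1, tangent_par c a.1 a.2 : 'rV[R]_n) |}.

Definition slit : charted ('rV[R]_n * 'rV[R]_n)%type := Charted slit_chart.

End SlitTangentBundle.

Section PullbackBundle.
Context {R : realType} {n : nat} {M : manifold R n}.

Definition proj : slit M -> M := @slit_proj R n M.

Definition pifield : Type := forall u : slit M, tangent (proj u).

Definition pifield_smooth_at (u : slit M) (Z : pifield) : Prop :=
  smooth_at (slit M) u (fun u' => dir (Z u') (crd (chart_at (proj u)))).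

Definition pifield_smooth (Z : pifield) : Prop :=
  forall u, pifield_smooth_at u Z.

Definition eta : pifield := fun u => (val u).2.

(** [insubd] is harmless: [(x, y + t w)] is a nonzero vector for small [t]. *)
Definition gamma_at (u : slit M) (w : tangent (proj u)) : tangent u :=
  velocity u (fun t : R => insubd u ((val u).1, (val u).2 + t *: (w : 'rV[R]_n))).

Definition gamma (Z : pifield) : vfield (slit M) := fun u => gamma_at (Z u).

Definition rho_at (u : slit M) (v : tangent u) : tangent (proj u) :=
  tmap proj v.

Definition rho (X : vfield (slit M)) : pifield := fun u => rho_at (X u).

Definition J (X : vfield (slit M)) : vfield (slit M) := gamma (rho X).

Definition Liouville : vfield (slit M) := gamma eta.

Definition d_J (f : slit M -> R) (X : vfield (slit M)) : slit M -> R :=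
  act (J X) f.

Definition energy (L : TM M -> R) (u : slit M) : R := 2^-1 * L (val u) ^+ 2.

Definition pos_homogeneous1 (f : TM M -> R) : Prop :=
  forall (x : M) (y : 'rV[R]_n) (t : R), 0 < t -> f (x, t *: y) = t * f (x, y).

(** Continuity of [L] along the zero section follows from the homogeneity. *)
Record finsler (L : TM M -> R) : Prop := Finsler {
  finsler_smooth : smooth (slit M) (fun u => L (val u));
  finsler_pos : forall u : slit M, 0 < L (val u);
  finsler_homogeneous : pos_homogeneous1 L;
  (* the 2-form dd_J E is nondegenerate *)
  finsler_nondegenerate : forall (u : slit M) (X : vfield (slit M)),
    vfield_smooth_at u X ->
    (forall Y, vfield_smooth_at u Y -> ext_d (d_J (energy L)) X Y u = 0) ->
    X u = 0
}.

Definition canonical_spray (L : TM M -> R) (G : vfield (slit M)) : Prop :=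
  vfield_smooth G /\
  forall (u : slit M) (Y : vfield (slit M)), vfield_smooth_at u Y ->
    ext_d (d_J (energy L)) G Y u = - act Y (energy L) u.

Section Connection.
Variable G : vfield (slit M).

Definition barthel (X : vfield (slit M)) : vfield (slit M) :=
  fun u => bracket (J X) G u - J (bracket X G) u.

Definition hproj (X : vfield (slit M)) : vfield (slit M) :=
  fun u => 2^-1 *: (X u + barthel X u).

Definition vproj (X : vfield (slit M)) : vfield (slit M) :=
  fun u => 2^-1 *: (X u - barthel X u).

Definition im_hproj (u : slit M) (w : tangent u) : Prop :=
  exists2 X : vfield (slit M), vfield_smooth_at u X & hproj X u = w.

(** The vector of the image of [hproj] with [rho (beta Z) = Z]. *)
Definition beta (Z : pifield) : vfield (slit M) := fun u =>
  get [set w : tangent u | im_hproj w /\ rho_at w = Z u].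

(** [gamma (K X) = vproj X]. *)
Definition K (X : vfield (slit M)) : pifield := fun u =>
  get [set w : tangent (proj u) | gamma_at w = vproj X u].

(** Every [X] is [gamma (K X) + beta (rho X)]. *)
Definition berwald (X : vfield (slit M)) (Y : pifield) : pifield := fun u =>
  rho (bracket (gamma (K X)) (beta Y)) u
  + K (bracket (beta (rho X)) (gamma Y)) u.

Definition curvature (X Y : vfield (slit M)) (Z : pifield) : pifield := fun u =>
  - berwald X (berwald Y Z) u + berwald Y (berwald X Z) u
  + berwald (bracket X Y) Z u.

Definition hv_curvature (X Y Z : pifield) : pifield :=
  curvature (beta X) (gamma Y) Z.

(** The value at [u] of [Tr {Z |-> A Z}], for [A] linear over functions: the
    trace of the endomorphism induced by [A] on the fibre over [u] (a matrix
    acting on row vectors). *)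
Definition pitrace (A : pifield -> pifield) (u : slit M) : R :=
  \tr (get [set B : 'M[R]_n | forall Z : pifield,
              pifield_smooth_at u Z -> (Z u : 'rV[R]_n) *m B = A Z u]).

Definition hv_trace (X Y : pifield) : slit M -> R :=
  pitrace (hv_curvature X Y).

Definition D_hv_trace (X : vfield (slit M)) (Y Z : pifield) (u : slit M) : R :=
  act X (hv_trace Y Z) u - hv_trace (berwald X Y) Z u
  - hv_trace Y (berwald X Z) u.

Definition douglas (X Y Z : pifield) : pifield := fun u =>
  hv_curvature X Y Z u
  - n.+1%:R^-1 *: (hv_trace X Y u *: Z u + hv_trace Y Z u *: X u
                   + hv_trace Z X u *: Y u)
  - n.+1%:R^-1 *: (D_hv_trace (gamma Y) X Z u *: eta u).

End Connection.

End PullbackBundle.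

(* Main.v *)
Require Import Defs.
From HB Require Import structures.
From mathcomp Require Import all_boot all_order all_algebra.
From mathcomp Require Import all_classical all_reals all_analysis.
From mathcomp Require Import ring.
Import Order.TTheory GRing.Theory Num.Theory.
Import numFieldNormedType.Exports.
Import Defs.
Local Open Scope classical_set_scope.
Local Open Scope ring_scope.

Set Implicit Arguments.
Unset Strict Implicit.
Unset Printing Implicit Defensive.

(** Work in the chart of the slit tangent bundle induced by a chart of [M], with
    coordinates [(x, y)].  A spray, that is a field [G] with rho G = eta, has the
    components [(y, - 2 F)] there.  Its Barthel connection has the coefficients
    [dF/dy], the Berwald connection is
    [D_A z = A . z + d^2 F/dy^2 (rho A, z)], and the hv-curvature is the third
    derivative of [F] along the fibre, a symmetric tensor ([dir_hv_curvature]).  As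
    derivatives commute with the trace, p is the second derivative along the fibre
    of the scalar function [S = div_y F] ([hv_traceE]), and the covariant derivative
    of p along a vertical lift is a third derivative of [S] ([D_hv_traceE]).  So the
    Douglas tensor is a linear differential expression in [F] ([douglasE]).

    The projective change [G' = G - 2 lambda C] replaces [F] by [F + lambda y].
    Because lambda is homogeneous of degree 1, [div_y (lambda y) = (n + 1) lambda],
    and hence [S' = S + (n + 1) lambda].  The third derivative of [lambda y] is the
    third derivative of lambda times [y], plus the cyclic sum of the second
    derivative of lambda in two arguments times the remaining one.  These are
    exactly the terms that the two trace corrections subtract
    ([local_douglas_projective]).

    That the canonical spray of a Finsler structure satisfies rho G = eta follows
    from its equation on vertical fields, from Euler's identity for the energy and
    from the nondegeneracy of dd_J E ([canonical_spray_rho]).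

    The formulas in one chart are meaningful because the bracket, defined at each
    point through the preferred chart of that point, has the usual components in
    every chart ([local_bracket]).  This, the curvature formula and the symmetry of
    the tensors above all rest on the symmetry of second derivatives
    ([derive_comm]). *)

(** * Directional derivatives *)

Section DirectionalDerivative.
Context {R : realType}.
Implicit Types V W Y : normedModType R.

Lemma derive_chain {V W Y} (f : V -> W) (g : W -> Y) a v :
  differentiable f a -> differentiable g (f a) ->
  'D_v (g \o f) a = 'D_('D_v f a) g (f a).
Proof.
move=> df dg; have dgf := differentiable_comp df dg.
by rewrite (deriveE v dgf) (deriveE v df) (deriveE _ dg) diff_comp.
Qed.

Lemma derive_chain_at {V W Y} (f : V -> W) (g : W -> Y) a b v : f a = b ->
  differentiable f a -> differentiable g b ->
  'D_v (g \o f) a = 'D_('D_v f a) g b.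
Proof. by move=> <-; exact: derive_chain. Qed.

Lemma derive_dirD {V W} (f : V -> W) a v w : differentiable f a ->
  'D_(v + w) f a = 'D_v f a + 'D_w f a.
Proof. by move=> df; rewrite !(deriveE _ df) linearD. Qed.

Lemma derive_opp {V W} (f : V -> W) a v : differentiable f a ->
  'D_v (fun x => - f x) a = - 'D_v f a.
Proof.
by move=> df; have /(_ v) df' := diff_derivable df; rewrite -[LHS]/('D_v (- f) a) deriveN.
Qed.

Lemma derive_dirZ {V W} (f : V -> W) a (k : R) v : differentiable f a ->
  'D_(k *: v) f a = k *: 'D_v f a.
Proof. by move=> df; rewrite !(deriveE _ df) linearZ. Qed.

Lemma derive_dirN {V W} (f : V -> W) a v : differentiable f a ->
  'D_(- v) f a = - 'D_v f a.
Proof. by move=> df; rewrite !(deriveE _ df) linearN. Qed.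

Lemma derive_dirB {V W} (f : V -> W) a v w : differentiable f a ->
  'D_(v - w) f a = 'D_v f a - 'D_w f a.
Proof. by move=> df; rewrite !(deriveE _ df) linearB. Qed.

Lemma derive_dir_sum {V W} (f : V -> W) a n (v : 'I_n -> V) :
  differentiable f a -> 'D_(\sum_i v i) f a = \sum_i 'D_(v i) f a.
Proof.
by move=> df; rewrite (deriveE _ df) linear_sum; apply: eq_bigr => i _; rewrite (deriveE _ df).
Qed.

Lemma derive_linear {V W} (f : {linear V -> W}) a v :
  continuous f -> 'D_v f a = f v.
Proof.
by move=> cf; rewrite (deriveE _ (linear_differentiable a cf)) diff_lin.
Qed.

Lemma derive_linear_comp {V W Y} (l : {linear W -> Y}) (f : V -> W) a v :
  continuous l -> differentiable f a -> 'D_v (l \o f) a = l ('D_v f a).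
Proof.
move=> cl df; rewrite (derive_chain v df (linear_differentiable _ cl)).
exact: derive_linear.
Qed.

Lemma derive_pair {V W Y} (f : V -> W) (g : V -> Y) a v :
  differentiable f a -> differentiable g a ->
  'D_v (fun x => (f x, g x)) a = ('D_v f a, 'D_v g a).
Proof.
move=> df dg; rewrite (deriveE v (differentiable_pair df dg)).
by rewrite (deriveE v df) (deriveE v dg) diff_pair.
Qed.

Lemma differentiable_affine {V} (x v : V) (s : R) :
  differentiable (fun t : R => x + t *: v) s.
Proof.
apply: differentiableD; first exact: differentiable_cst.
by apply: ex_diff; exact: is_diff_scalel.
Qed.

Lemma derive_affine {V} (x v : V) (s : R) : 'D_1 (fun t : R => x + t *: v) s = v.
Proof.
have dscal : is_diff s ( *:%R^~ v : R -> V) ( *:%R^~ v) by exact: is_diff_scalel.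
have ds := @ex_diff _ _ _ _ _ _ _ dscal.
rewrite deriveD//; last exact: diff_derivable.
by rewrite (derive_cst x) add0r (deriveE _ ds) diff_val scale1r.
Qed.

(** Scaling under a name of its own, which carries the bilinear structure. *)
Definition scaleM {W} (k : R) (w : W) : W := k *: w.

Lemma scaleM_is_bilinear {W} :
  bilinear_for
    (GRing.Scale.Law.clone _ _ *:%R _) (GRing.Scale.Law.clone _ _ *:%R _)
    (@scaleM W : R -> W -> W).
Proof.
split=> [u'|u] a x y /=; rewrite /scaleM.
- by rewrite scalerDl scalerA.
- by rewrite scalerDr !scalerA mulrC.
Qed.

HB.instance Definition _ W := bilinear_isBilinear.Build R R W W _ _
  (@scaleM W : R -> W -> W) (@scaleM_is_bilinear W).

Lemma differentiable_scale {V W} (k : V -> R) (f : V -> W) a :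
  differentiable k a -> differentiable f a -> differentiable (fun x => k x *: f x) a.
Proof.
move=> dk df.
apply: (@differentiable_comp _ _ _ _ (fun x => (k x, f x)) (fun p => scaleM p.1 p.2)).
  exact: differentiable_pair.
by apply: differentiable_bilin => p; exact: scale_continuous.
Qed.

Lemma derive_scale {V W} (k : V -> R) (f : V -> W) a v :
  differentiable k a -> differentiable f a ->
  'D_v (fun x => k x *: f x) a = 'D_v k a *: f a + k a *: 'D_v f a.
Proof.
move=> dk df.
have cM : continuous (fun p : R * W => scaleM p.1 p.2).
  by move=> p; exact: scale_continuous.
have dp := differentiable_pair dk df.
have dM := @differentiable_bilin _ _ _ _ (@scaleM W) (k a, f a) cM.
have /= -> := derive_chain v dp dM.
by rewrite derive_pair// (deriveE _ dM) diff_bilin//= addrC.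
Qed.

End DirectionalDerivative.

(** * Spaces with finitely many linear coordinates *)

Section Framed.
Context {R : realType}.

(** A finite family of vectors with continuous dual coordinates.  Through it the
    derivative in a variable direction is a finite sum of products of scalars
    with derivatives in fixed directions, the only ones that [class_C] speaks
    about. *)
Class framed (V : normedModType R) := Framed {
  fdim : nat;
  fvec : 'I_fdim -> V;
  fcoord : 'I_fdim -> {linear V -> R};
  fcoord_cont : forall i, continuous (fcoord i);
  fcoordE : forall x, x = \sum_i fcoord i x *: fvec i }.

Lemma framed_eq {V} {fV : framed V} (x y : V) :
  (forall i, fcoord i x = fcoord i y) -> x = y.
Proof. by move=> h; rewrite (fcoordE x) (fcoordE y); apply: eq_bigr => i _; rewrite h. Qed.

Section row.
Variable n : nat.

Definition row_coord (i : 'I_n) (x : 'rV[R]_n) : R := x 0 i.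

Lemma row_coord_is_linear i : linear (row_coord i).
Proof. by move=> a x y; rewrite /row_coord !mxE. Qed.

HB.instance Definition _ i := GRing.isLinear.Build R _ _ _ (row_coord i)
  (@row_coord_is_linear i).

Lemma row_coord_cont i : continuous (row_coord i).
Proof. exact: coord_continuous. Qed.

Lemma row_coordE (x : 'rV[R]_n) : x = \sum_i row_coord i x *: delta_mx 0 i.
Proof. exact: row_sum_delta. Qed.

#[export] Instance framed_row : framed 'rV[R]_n :=
  Framed row_coord_cont row_coordE.

End row.

Lemma fst_is_linear (V W : lmodType R) : linear (@fst V W).
Proof. by []. Qed.
Lemma snd_is_linear (V W : lmodType R) : linear (@snd V W).
Proof. by []. Qed.

Section pair.
Context {V W : normedModType R} {fV : framed V} {fW : framed W}.

Definition pair_coord (i : 'I_(@fdim V fV + @fdim W fW)) (x : V * W) : R :=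
  match fintype.split i with inl j => fcoord j x.1 | inr j => fcoord j x.2 end.

Definition pair_vec (i : 'I_(@fdim V fV + @fdim W fW)) : V * W :=
  match fintype.split i with inl j => (fvec j, 0) | inr j => (0, fvec j) end.

Lemma pair_coord_is_linear i : linear (pair_coord i).
Proof.
by move=> a x y; rewrite /pair_coord; case: fintype.split => j /=; rewrite linearP.
Qed.

HB.instance Definition _ i := GRing.isLinear.Build R _ _ _ (pair_coord i)
  (@pair_coord_is_linear i).

Lemma pair_coord_cont i : continuous (pair_coord i).
Proof.
rewrite /pair_coord; case: fintype.split => j x.
- apply: (@continuous_comp _ _ _ fst (fcoord j)); [exact: cvg_fst|exact: fcoord_cont].
- apply: (@continuous_comp _ _ _ snd (fcoord j)); [exact: cvg_snd|exact: fcoord_cont].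
Qed.

Lemma pair_coordE (x : V * W) : x = \sum_i pair_coord i x *: pair_vec i.
Proof.
rewrite big_split_ord /=.
under eq_bigr => i _ do rewrite /pair_coord /pair_vec (unsplitK (inl i)).
under [X in _ + X]eq_bigr => i _ do rewrite /pair_coord /pair_vec (unsplitK (inr i)).
have fstD m (s : 'I_m -> V * W) : (\sum_i s i).1 = \sum_i (s i).1.
  by rewrite (big_morph fst (id1 := 0) (op1 := +%R)).
have sndD m (s : 'I_m -> V * W) : (\sum_i s i).2 = \sum_i (s i).2.
  by rewrite (big_morph snd (id1 := 0) (op1 := +%R)).
have z0 (U : lmodType R) m (c : 'I_m -> R) : \sum_i c i *: (0 : U) = 0.
  by apply: big1 => i _; rewrite scaler0.
case: x => x y /=; apply/pair_equal_spec; split.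
  by rewrite [RHS]/= !fstD /= z0 addr0 -fcoordE.
by rewrite [RHS]/= !sndD /= z0 add0r -fcoordE.
Qed.

#[export] Instance framed_pair : framed (V * W)%type :=
  Framed pair_coord_cont pair_coordE.

End pair.
End Framed.

(** * Smooth maps *)

Section Smooth.
Context {R : realType}.
Implicit Types V W Y : normedModType R.

Lemma near_open_eq {V W} (U : set V) (f g : V -> W) x : open U -> U x ->
  (forall y, U y -> f y = g y) -> \near x, f x = g x.
Proof.
by move=> oU Ux fg; apply: filterS (open_nbhs_nbhs (conj oU Ux)) => y /fg.
Qed.

Lemma near_eq_continuous {V W} (f g : V -> W) x : (\near x, f x = g x) ->
  {for x, continuous f} -> {for x, continuous g}.
Proof.
move=> fg cf; rewrite /prop_for /continuous_at -(nbhs_singleton fg).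
exact: cvg_trans (near_eq_cvg fg) cf.
Qed.

(** [g - f] vanishes near [x], so its differential at [x] is 0. *)
Lemma near_eq_differentiable {V W} (f g : V -> W) x : (\near x, f x = g x) ->
  differentiable f x -> differentiable g x.
Proof.
move=> fg df; pose r : V -> W := g - f.
have r0 : r \o shift x = cst (r x) + (\0 : {linear V -> W}) +o_ 0 id.
  apply/eqaddoP => _/posnumP[e]; near=> h.
  have fgh : f (h + x) = g (h + x).
    near: h; move: fg; rewrite (near_shift 0 x) /=.
    by apply: filterS => y; rewrite subr0.
  rewrite /r !fctE /= fgh (nbhs_singleton fg) !subrr addr0 subr0 normr0.
  by rewrite mulr_ge0.
have dr : differentiable r x.
  have z : 'd r x = (\0 : {linear V -> W}) :> (V -> W).
    by apply: diff_unique r0 => y; exact: cst_continuous.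
  by apply/diff_locallyP; rewrite z; split => // y; exact: cst_continuous.
suff -> : g = f + r by exact: differentiableD.
by apply/funext => y; rewrite /r !fctE addrC subrK.
Unshelve. all: by end_near. Qed.

(** The set must be open: derivatives at a point of [U] see a neighbourhood of
    that point. *)
Lemma class_C_ext {V W} k (U : set V) (f g : V -> W) : open U ->
  (forall x, U x -> f x = g x) -> class_C k U f -> class_C k U g.
Proof.
move=> oU; elim: k f g => [|k IH] f g fg /=.
  by move=> cf x Ux; apply: near_eq_continuous (cf x Ux); exact: near_open_eq fg.
move=> [df Df]; split => [x Ux|v].
  by apply: near_eq_differentiable (df x Ux); exact: near_open_eq fg.
apply: IH (Df v) => x Ux; apply: near_eq_derive; exact: near_open_eq fg.
Qed.

Lemma class_C_sub {V W} k (U U' : set V) (f : V -> W) : U' `<=` U ->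
  class_C k U f -> class_C k U' f.
Proof.
move=> sU; elim: k f => [|k IH] f /=; first by move=> cf x /sU /cf.
by move=> [df Df]; split => [x /sU /df//|v]; exact: IH.
Qed.

Lemma class_C_pred {V W} k (U : set V) (f : V -> W) :
  class_C k.+1 U f -> class_C k U f.
Proof.
elim: k f => [|k IH] f; last by move=> [df Df]; split => // v; exact: IH.
by move=> [df _] x Ux; exact: differentiable_continuous (df x Ux).
Qed.

Lemma class_C_cst {V W} k (U : set V) (w : W) : class_C k U (fun=> w).
Proof.
elim: k w => [|k IH] w /=; first by move=> x _; exact: cst_continuous.
split=> [x _|v]; first exact: differentiable_cst.
suff -> : (fun x => 'D_v (fun=> w) x) = fun=> 0 :> W by [].
by apply/funext => x; exact: derive_cst.
Qed.

Lemma class_CD {V W} k (U : set V) (f g : V -> W) : open U ->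
  class_C k U f -> class_C k U g -> class_C k U (fun x => f x + g x).
Proof.
move=> oU; elim: k f g => [|k IH] f g /=.
  by move=> cf cg x Ux; apply: continuousD; [exact: cf|exact: cg].
move=> [df Df] [dg Dg]; split=> [x Ux|v].
  by apply: differentiableD; [exact: df|exact: dg].
apply: class_C_ext (IH _ _ (Df v) (Dg v)) => // x Ux /=.
by rewrite [RHS]deriveD//; apply: diff_derivable; [exact: df|exact: dg].
Qed.

Lemma class_C_scale {V W} k (U : set V) (f : V -> R) (g : V -> W) : open U ->
  class_C k U f -> class_C k U g -> class_C k U (fun x => f x *: g x).
Proof.
move=> oU; elim: k f g => [|k IH] f g Cf Cg.
  by move=> x Ux; apply: continuousZ; [exact: Cf|exact: Cg].
have [df Df] := Cf; have [dg Dg] := Cg; split=> [x Ux|v].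
  by apply: differentiable_scale; [exact: df|exact: dg].
have h1 := IH _ _ (Df v) (class_C_pred Cg).
have h2 := IH _ _ (class_C_pred Cf) (Dg v).
apply: class_C_ext (class_CD oU h1 h2) => // x Ux /=.
by rewrite derive_scale//; [exact: df|exact: dg].
Qed.

Lemma class_C_linear {V W Y} k (U : set V) (l : {linear W -> Y}) (f : V -> W) :
  continuous l -> open U -> class_C k U f -> class_C k U (fun x => l (f x)).
Proof.
move=> cl oU; elim: k f => [|k IH] f.
  by move=> Cf x Ux; apply: continuous_comp; [exact: Cf|exact: cl].
move=> [df Df]; split=> [x Ux|v].
  apply: (differentiable_comp (df x Ux)); exact: linear_differentiable.
apply: class_C_ext (IH _ (Df v)) => // x Ux /=.
by rewrite -[RHS]/('D_v (l \o f) x) derive_linear_comp//; exact: df.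
Qed.

Lemma class_C_pair {V W Y} k (U : set V) (f : V -> W) (g : V -> Y) : open U ->
  class_C k U f -> class_C k U g -> class_C k U (fun x => (f x, g x)).
Proof.
move=> oU; elim: k f g => [|k IH] f g.
  by move=> Cf Cg x Ux; apply: cvg_pair; [exact: Cf|exact: Cg].
move=> [df Df] [dg Dg]; split=> [x Ux|v].
  by apply: differentiable_pair; [exact: df|exact: dg].
apply: class_C_ext (IH _ _ (Df v) (Dg v)) => // x Ux /=.
by rewrite derive_pair//; [exact: df|exact: dg].
Qed.

Lemma class_C_sum {V W} k (U : set V) m (f : 'I_m -> V -> W) : open U ->
  (forall i, class_C k U (f i)) -> class_C k U (fun x => \sum_i f i x).
Proof.
move=> oU; elim: m f => [|m IH] f Cf.
  apply: class_C_ext (@class_C_cst _ _ k U (0 : W)) => // x _.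
  by rewrite big_ord0.
apply: class_C_ext (class_CD oU (Cf ord0) (IH _ (fun i => Cf (lift ord0 i)))) => // x _.
by rewrite big_ord_recl.
Qed.

Lemma derive_frame {V} {fV : framed V} {W} (f : V -> W) a v :
  differentiable f a -> 'D_v f a = \sum_i fcoord i v *: 'D_(fvec i) f a.
Proof.
move=> df; rewrite {1}(fcoordE v) derive_dir_sum//.
by apply: eq_bigr => i _; rewrite derive_dirZ.
Qed.

(** By the chain rule a derivative of [g \o f] is a sum of products of
    coordinates of a derivative of [f] with functions ['D_e g \o f], to which the
    induction hypothesis applies because [f] is also of class one less. *)
Lemma class_C_comp {V W Y} {fW : framed W} k (U : set V) (U' : set W)
    (f : V -> W) (g : W -> Y) : open U -> (forall x, U x -> U' (f x)) ->
  class_C k U f -> class_C k U' g -> class_C k U (fun x => g (f x)).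
Proof.
move=> oU fU; elim: k f fU g => [|k IH] f fU g Cf Cg.
  by move=> x Ux; apply: continuous_comp; [exact: Cf|exact/Cg/fU].
have [df Df] := Cf; have [dg Dg] := Cg; split=> [x Ux|v].
  by apply: (differentiable_comp (df x Ux)); exact/dg/fU.
have h (i : 'I_(@fdim _ _ fW)) :
    class_C k U (fun x => fcoord i ('D_v f x) *: 'D_(fvec i) g (f x)).
  apply: class_C_scale => //.
    exact: (class_C_linear (@fcoord_cont _ _ fW i) oU (Df v)).
  exact: IH (fun x => 'D_(fvec i) g x) (class_C_pred Cf) (Dg _).
apply: class_C_ext (class_C_sum oU h) => // x Ux /=.
by rewrite -[RHS]/('D_v (g \o f) x) derive_chain -?derive_frame//; [exact/dg/fU|exact: df|exact/dg/fU].
Qed.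

End Smooth.

Section SmoothNear.
Context {R : realType}.
Implicit Types V W Y : normedModType R.

(** [smooth_at N x f] is this property, by definition, of the expression of [f] in
    the preferred chart at [x]. *)
Definition smooth_near {V W} (a : V) (f : V -> W) : Prop :=
  exists U : set V, [/\ open U, U a & smooth_on U f].

Lemma smooth_near_nbhs {V W} (a : V) (f : V -> W) :
  smooth_near a f -> \near a, smooth_near a f.
Proof.
move=> [U [oU Ua sf]]; apply: filterS (open_nbhs_nbhs (conj oU Ua)) => x Ux.
by exists U.
Qed.

Lemma smooth_near_ext {V W} (a : V) (f g : V -> W) :
  (\near a, f a = g a) -> smooth_near a f -> smooth_near a g.
Proof.
move=> fg [U [oU Ua sf]].
exists (U `&` (fun x => f x = g x)°); split.
- exact: openI oU (open_interior _).
- by split.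
- move=> k; apply: class_C_ext (class_C_sub (@subIsetl _ _ _) (sf k)).
    exact: openI oU (open_interior _).
  by move=> x [_ /nbhs_singleton].
Qed.

Lemma smooth_near_diff {V W} (a : V) (f : V -> W) :
  smooth_near a f -> differentiable f a.
Proof. by move=> [U [_ Ua /(_ 1)[+ _]]]; apply. Qed.

Lemma smooth_near_derive {V W} (a v : V) (f : V -> W) :
  smooth_near a f -> smooth_near a (fun x => 'D_v f x).
Proof. by move=> [U [oU Ua sf]]; exists U; split => // k; have [_ /(_ v)] := sf k.+1. Qed.

Lemma smooth_near_cst {V W} (a : V) (w : W) : smooth_near a (fun=> w).
Proof. by exists setT; split => //; [exact: openT|move=> k; exact: class_C_cst]. Qed.

Lemma smooth_near_binary {V W Y} {Z : normedModType R} (a : V) (f : V -> W) (g : V -> Y)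
    (h : V -> Z) :
  (forall k U, open U -> class_C k U f -> class_C k U g -> class_C k U h) ->
  smooth_near a f -> smooth_near a g -> smooth_near a h.
Proof.
move=> H [U [oU Ua sf]] [U' [oU' Ua' sg]].
exists (U `&` U'); split => //; first exact: openI.
move=> k; apply: H; first exact: openI.
- exact: class_C_sub (@subIsetl _ _ _) (sf k).
- exact: class_C_sub (@subIsetr _ _ _) (sg k).
Qed.

Lemma smooth_nearD {V W} (a : V) (f g : V -> W) :
  smooth_near a f -> smooth_near a g -> smooth_near a (fun x => f x + g x).
Proof. by apply: smooth_near_binary => k U oU; exact: class_CD. Qed.

Lemma smooth_near_scale {V W} (a : V) (f : V -> R) (g : V -> W) :
  smooth_near a f -> smooth_near a g -> smooth_near a (fun x => f x *: g x).
Proof. by apply: smooth_near_binary => k U oU; exact: class_C_scale. Qed.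

Lemma smooth_near_pair {V W Y} (a : V) (f : V -> W) (g : V -> Y) :
  smooth_near a f -> smooth_near a g -> smooth_near a (fun x => (f x, g x)).
Proof. by apply: smooth_near_binary => k U oU; exact: class_C_pair. Qed.

Lemma smooth_nearZ {V W} (a : V) (k : R) (f : V -> W) :
  smooth_near a f -> smooth_near a (fun x => k *: f x).
Proof. exact: smooth_near_scale (smooth_near_cst _ _). Qed.

Lemma smooth_nearN {V W} (a : V) (f : V -> W) :
  smooth_near a f -> smooth_near a (fun x => - f x).
Proof.
move=> /(smooth_nearZ (-1)); apply: smooth_near_ext.
by near=> x; rewrite scaleN1r.
Unshelve. all: by end_near. Qed.

Lemma smooth_nearB {V W} (a : V) (f g : V -> W) :
  smooth_near a f -> smooth_near a g -> smooth_near a (fun x => f x - g x).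
Proof. by move=> sf /smooth_nearN; exact: smooth_nearD. Qed.

Lemma smooth_near_sum {V W} (a : V) m (f : 'I_m -> V -> W) :
  (forall i, smooth_near a (f i)) -> smooth_near a (fun x => \sum_i f i x).
Proof.
elim: m f => [|m IH] f sf.
  apply: smooth_near_ext (smooth_near_cst a 0).
  by near=> x; rewrite big_ord0.
apply: smooth_near_ext (smooth_nearD (sf ord0) (IH _ (fun i => sf (lift ord0 i)))).
by near=> x; rewrite big_ord_recl.
Unshelve. all: by end_near. Qed.

Lemma smooth_near_linear {V W Y} (l : {linear W -> Y}) (a : V) (f : V -> W) :
  continuous l -> smooth_near a f -> smooth_near a (fun x => l (f x)).
Proof.
move=> cl [U [oU Ua sf]]; exists U; split => // k.
exact: class_C_linear.
Qed.

Lemma smooth_near_id {V} (a : V) : smooth_near a id.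
Proof.
exists setT; split => //; first exact: openT.
case=> [|k]; first by move=> x _; exact: cvg_id.
split=> [x _|v]; first by apply: ex_diff; exact: is_diff_id.
suff -> : (fun x => 'D_v id x) = fun=> v by exact: class_C_cst.
by apply/funext => x; exact: derive_id.
Qed.

HB.instance Definition _ (V W : lmodType R) :=
  GRing.isLinear.Build R (V * W)%type V _ fst (@fst_is_linear R V W).
HB.instance Definition _ (V W : lmodType R) :=
  GRing.isLinear.Build R (V * W)%type W _ snd (@snd_is_linear R V W).

Lemma continuous_fst {V W} : continuous (@fst V W).
Proof. by move=> x; exact: cvg_fst. Qed.

Lemma continuous_snd {V W} : continuous (@snd V W).
Proof. by move=> x; exact: cvg_snd. Qed.

Lemma smooth_near_fst {V W Y} (a : V) (f : V -> W * Y) :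
  smooth_near a f -> smooth_near a (fun x => (f x).1).
Proof. by move=> sf; apply: (@smooth_near_linear _ _ _ fst) => //; exact: continuous_fst. Qed.

Lemma smooth_near_snd {V W Y} (a : V) (f : V -> W * Y) :
  smooth_near a f -> smooth_near a (fun x => (f x).2).
Proof. by move=> sf; apply: (@smooth_near_linear _ _ _ snd) => //; exact: continuous_snd. Qed.

Lemma derive_fst {V W Y} (a v : V) (f : V -> W * Y) : differentiable f a ->
  'D_v (fun x => (f x).1) a = ('D_v f a).1.
Proof. by move=> df; rewrite (@derive_linear_comp _ _ _ _ fst)//; exact: continuous_fst. Qed.

Lemma derive_snd {V W Y} (a v : V) (f : V -> W * Y) : differentiable f a ->
  'D_v (fun x => (f x).2) a = ('D_v f a).2.
Proof. by move=> df; rewrite (@derive_linear_comp _ _ _ _ snd)//; exact: continuous_snd. Qed.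

Lemma derive_comp_fst {V W Y} (f : V -> Y) (a v : V * W) : differentiable f a.1 ->
  'D_v (fun b => f b.1) a = 'D_(v.1) f a.1.
Proof.
move=> df; have sf : smooth_near a (fst : V * W -> V) := smooth_near_fst (smooth_near_id a).
rewrite -[LHS]/('D_v (f \o fst) a) (derive_chain v (smooth_near_diff sf) df).
by rewrite (derive_fst v (smooth_near_diff (smooth_near_id a))) derive_id.
Qed.

Lemma smooth_near_comp {V W Y} {fW : framed W} (a : V) (f : V -> W) (g : W -> Y) :
  smooth_near a f -> smooth_near (f a) g -> smooth_near a (fun x => g (f x)).
Proof.
move=> sf; have cf := differentiable_continuous (smooth_near_diff sf).
move: sf => [U [oU Ua sf]] [U' [oU' Ua' sg]].
have nU : nbhs a (f @^-1` U') by apply: cf; exact: open_nbhs_nbhs.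
have sI := @subIsetl _ U (f @^-1` U')°.
have oI : open (U `&` (f @^-1` U')°) := openI oU (open_interior _).
exists (U `&` (f @^-1` U')°); split => // k.
apply: (@class_C_comp _ _ _ _ _ k _ U') => //; first by move=> x [_ /nbhs_singleton].
exact: class_C_sub sI (sf k).
Qed.

(** In a frame the derivative of [f] along [X] is a sum of products of the
    coordinates of [X] with derivatives of [f] in fixed directions. *)
Lemma smooth_near_along {V W} {fV : framed V} (a : V) (X : V -> V) (f : V -> W) :
  smooth_near a X -> smooth_near a f -> smooth_near a (fun x => 'D_(X x) f x).
Proof.
move=> sX sf.
have h (i : 'I_(@fdim _ _ fV)) :
    smooth_near a (fun x => fcoord i (X x) *: 'D_(fvec i) f x).
  apply: smooth_near_scale; last exact: smooth_near_derive.
  exact: (smooth_near_linear (@fcoord_cont _ _ fV i)).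
apply: smooth_near_ext (smooth_near_sum h).
near=> x; rewrite -derive_frame//; apply: smooth_near_diff.
by near: x; exact: smooth_near_nbhs.
Unshelve. all: by end_near. Qed.

Lemma derive_sum_fun {V W} (a v : V) m (f : 'I_m -> V -> W) :
  (forall i, differentiable (f i) a) ->
  'D_v (fun x => \sum_i f i x) a = \sum_i 'D_v (f i) a.
Proof.
move=> df; have -> : (fun x => \sum_i f i x) = \sum_i f i.
  by apply/funext => x; rewrite fct_sumE.
by rewrite derive_sum// => i; exact: diff_derivable.
Qed.

(** Leibniz rule for the pairing of the differential of [f] with the field [X]. *)
Lemma derive_along {V W} {fV : framed V} (a v : V) (X : V -> V) (f : V -> W) :
  differentiable X a -> smooth_near a f ->
  'D_v (fun x => 'D_(X x) f x) a = 'D_v (fun x => 'D_(X a) f x) a + 'D_('D_v X a) f a.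
Proof.
move=> dX sf; have df := smooth_near_diff sf.
have dDf w : differentiable (fun x => 'D_w f x) a.
  exact: smooth_near_diff (smooth_near_derive w sf).
have fc i := @fcoord_cont _ _ fV i.
have dcX i : differentiable (fun x => fcoord i (X x)) a.
  by apply: (differentiable_comp dX); exact: linear_differentiable.
have E (Y : V -> V) : \near a, 'D_(Y a) f a = \sum_i fcoord i (Y a) *: 'D_(fvec i) f a.
  near=> x; rewrite -derive_frame//; apply: smooth_near_diff.
  by near: x; exact: smooth_near_nbhs.
rewrite (near_eq_derive _ (E X)) (near_eq_derive _ (E (fun=> X a))).
rewrite derive_sum_fun; last by move=> i; exact: differentiable_scale.
rewrite derive_sum_fun; last first.
  by move=> i; apply: differentiable_scale => //; exact: differentiable_cst.
rewrite (derive_frame _ df) -big_split /=; apply: eq_bigr => i _.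
have dc : differentiable (fun=> fcoord i (X a) : R) a by exact: differentiable_cst.
rewrite (derive_scale v (dcX i) (dDf _)) (derive_scale v dc (dDf _)).
rewrite (derive_cst (fcoord i (X a))) scale0r add0r addrC.
by rewrite -(derive_linear_comp v (fc i) dX).
Unshelve. all: by end_near. Qed.

End SmoothNear.

(** * Symmetry of second derivatives *)

Section Schwarz.
Context {R : realType}.
Implicit Types V W : normedModType R.

Lemma is_derive_line {V} (f : V -> R) (x v : V) (s : R) :
  differentiable f (x + s *: v) ->
  is_derive s 1 (fun t : R => f (x + t *: v)) ('D_v f (x + s *: v)).
Proof.
move=> df; have dl := differentiable_affine x v s.
split; first exact: (diff_derivable (differentiable_comp dl df)).
by have := derive_chain (1 : R) dl df; rewrite derive_affine.
Qed.

Lemma dist_via (x y p q e : R) : p = q -> `|x - p| < e / 2 -> `|y - q| < e / 2 ->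
  `|x - y| <= e.
Proof.
move=> -> hx hy; rewrite -(subrK q x) -addrA.
apply: le_trans (ler_normD _ _) _.
by rewrite (splitr e) lerD// ltW// distrC.
Qed.

(** The mean value theorem along [v] for the increment of [f] by [t *: w], then
    along [w] for ['D_v f].  The second difference on the left does not
    distinguish [v] from [w]. *)
Lemma mean_value2 {V} (f : V -> R) (a v w : V) (t : R) : 0 < t ->
  (forall s r, 0 <= s <= t -> 0 <= r <= t ->
    differentiable f (a + s *: v + r *: w) /\
    differentiable (fun x => 'D_v f x) (a + s *: v + r *: w)) ->
  exists s r, [/\ 0 <= s <= t, 0 <= r <= t &
    f (a + t *: v + t *: w) - f (a + t *: v) - (f (a + t *: w) - f a) =
    'D_w (fun x => 'D_v f x) (a + s *: v + r *: w) * t * t].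
Proof.
move=> t0 dfU; have t1 : 0 <= t <= t by rewrite lexx ltW.
have z1 : 0 <= (0 : R) <= t by rewrite lexx ltW.
pose phi (s : R) := f (a + t *: w + s *: v) - f (a + s *: v).
have dphi (s : R) : s \in `[0, t] -> is_derive s 1 phi
    ('D_v f (a + s *: v + t *: w) - 'D_v f (a + s *: v)).
  rewrite in_itv /= => st; apply: is_deriveB; last first.
    by apply: is_derive_line; have [+ _] := dfU s 0 st z1; rewrite scale0r addr0.
  rewrite addrAC; apply: is_derive_line; rewrite addrAC.
  by have [] := dfU s t st t1.
have oocc (x : R) : x \in `]0, t[ -> x \in `[0, t].
  by rewrite !in_itv /= => /andP[/ltW -> /ltW ->].
have [|s /oocc st E1] := MVT t0 (fun x xt => dphi x (oocc x xt)).
  by apply: derivable_within_continuous => x xt; have [] := dphi x xt.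
have {}st : 0 <= s <= t by move: st; rewrite in_itv.
pose psi (r : R) := 'D_v f (a + s *: v + r *: w).
have dpsi (r : R) : r \in `[0, t] -> is_derive r 1 psi
    ('D_w (fun x => 'D_v f x) (a + s *: v + r *: w)).
  rewrite in_itv /= => rt.
  by apply: (is_derive_line (f := fun x => 'D_v f x)); have [] := dfU s r st rt.
have [|r /oocc rt E2] := MVT t0 (fun x xt => dpsi x (oocc x xt)).
  by apply: derivable_within_continuous => x xt; have [] := dpsi x xt.
have {}rt : 0 <= r <= t by move: rt; rewrite in_itv.
exists s, r; split => //.
move: E1 E2; rewrite /phi /psi !scale0r !addr0 subr0 => E1 E2.
by rewrite -E2 -E1 [a + t *: v + _]addrAC.
Qed.

(** Schwarz's theorem.  The second difference of [f] on a small parallelogram is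
    a value of either mixed derivative near [a], up to the same factor; so the two
    continuous mixed derivatives share values arbitrarily near [a]. *)
Lemma derive_comm_scalar {V} (f : V -> R) (a v w : V) : smooth_near a f ->
  'D_w (fun x => 'D_v f x) a = 'D_v (fun x => 'D_w f x) a.
Proof.
move=> sf.
pose vw x := 'D_w (fun x => 'D_v f x) x; pose wv x := 'D_v (fun x => 'D_w f x) x.
rewrite -/(vw a) -/(wv a); apply/eqP; rewrite -subr_eq0 -normr_eq0.
apply/eqP/le_anti; rewrite normr_ge0 andbT; apply/ler_addgt0Pl => e e0; rewrite addr0.
have cvw : vw x @[x --> a] --> vw a.
  by apply/differentiable_continuous/smooth_near_diff; do 2![apply: smooth_near_derive].
have cwv : wv x @[x --> a] --> wv a.
  by apply/differentiable_continuous/smooth_near_diff; do 2![apply: smooth_near_derive].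
have e2 : 0 < e / 2 by rewrite divr_gt0.
have good : \forall x \near a, [/\ smooth_near x f, `|vw a - vw x| < e / 2 & `|wv a - wv x| < e / 2].
  have n1 : \forall x \near a, `|vw a - vw x| < e / 2 by exact: ((cvgrPdist_lt _ _).1 cvw _ e2).
  have n2 : \forall x \near a, `|wv a - wv x| < e / 2 by exact: ((cvgrPdist_lt _ _).1 cwv _ e2).
  by apply: filterS3 (smooth_near_nbhs sf) n1 n2.
have [d d0 hd] := (nbhs_ballP _ _).1 good.
rewrite /= in d0.
pose c := `|v| + `|w| + 1.
have c0 : 0 < c by rewrite ltr_wpDl// addr_ge0.
(* With this side, the parallelogram spanned by [t *: v] and [t *: w] at [a]
   lies in the ball of radius [d]. *)
pose t := d / 2 / c.
have t0 : 0 < t by rewrite !divr_gt0.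
have H s r : 0 <= s <= t -> 0 <= r <= t ->
   [/\ smooth_near (a + s *: v + r *: w) f, `|vw a - vw (a + s *: v + r *: w)| < e / 2
    & `|wv a - wv (a + s *: v + r *: w)| < e / 2].
  move=> /andP[s0 st] /andP[r0 rt]; apply: hd.
  rewrite -ball_normE /= -addrA opprD addNKr normrN.
  have sv : `|s *: v| <= t * `|v| by rewrite normrZ ger0_norm// ler_wpM2r.
  have rw : `|r *: w| <= t * `|w| by rewrite normrZ ger0_norm// ler_wpM2r.
  apply: le_lt_trans (ler_normD _ _) _; apply: le_lt_trans (lerD sv rw) _.
  rewrite -mulrDr; apply: (@le_lt_trans _ _ (t * c)).
    by rewrite ler_wpM2l ?(ltW t0)// lerDl.
  by rewrite /t divfK ?gt_eqF// ltr_pdivrMr// ltr_pMr// ltr1n.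
have [|s1 [r1 [s1t r1t E1]]] := @mean_value2 _ f a v w t t0.
  by move=> s r st rt; have [sx _ _] := H s r st rt; split; apply: smooth_near_diff => //;
    exact: smooth_near_derive.
have [|s2 [r2 [s2t r2t E2]]] := @mean_value2 _ f a w v t t0.
  move=> s r st rt; rewrite addrAC; have [sx _ _] := H r s rt st.
  by split; apply: smooth_near_diff => //; exact: smooth_near_derive.
have comm_t : f (a + t *: v + t *: w) - f (a + t *: v) - (f (a + t *: w) - f a) =
    f (a + t *: w + t *: v) - f (a + t *: w) - (f (a + t *: v) - f a).
  rewrite [a + t *: v + _]addrAC.
  by rewrite !opprB !addrA [LHS]addrAC [RHS]addrAC [X in X + _]addrAC.
have [_ h1 _] := H _ _ s1t r1t; have [_ _ h2] := H _ _ r2t s2t.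
have {}E2 : f (a + t *: w + t *: v) - f (a + t *: w) - (f (a + t *: v) - f a) =
    wv (a + r2 *: v + s2 *: w) * t * t by rewrite [a + r2 *: v + _]addrAC; exact: E2.
apply: dist_via h1 h2.
have tt : t != 0 by rewrite gt_eqF.
exact: (mulIf tt (mulIf tt (etrans (esym E1) (etrans comm_t E2)))).
Qed.

Lemma derive_comm {V W} {fW : framed W} (f : V -> W) (a v w : V) : smooth_near a f ->
  'D_w (fun x => 'D_v f x) a = 'D_v (fun x => 'D_w f x) a.
Proof.
move=> sf; apply: framed_eq => i; have fc := @fcoord_cont _ _ fW i.
have dD u : differentiable (fun x => 'D_u f x) a.
  exact/smooth_near_diff/smooth_near_derive.
have E u : \near a, fcoord i ('D_u f a) = 'D_u (fcoord i \o f) a.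
  near=> x; rewrite derive_linear_comp//; apply: smooth_near_diff.
  by near: x; exact: smooth_near_nbhs.
rewrite -(derive_linear_comp w fc (dD v)) -(derive_linear_comp v fc (dD w)).
rewrite (near_eq_derive _ (E v)) (near_eq_derive _ (E w)).
by apply: derive_comm_scalar; exact: smooth_near_linear.
Unshelve. all: by end_near. Qed.

End Schwarz.

(** * Vertical derivatives *)

Section SecondOrder.
Context {R : realType} {V W : normedModType R} {fV : framed V}.
Implicit Types (a v : V) (f : V -> W) (X Y : V -> V).

Lemma derive2_frame a u v f : smooth_near a f ->
  'D_v (fun x => 'D_u f x) a =
  \sum_i fcoord i u *: 'D_v (fun x => 'D_(fvec i) f x) a.
Proof.
move=> sf.
have E : \forall x \near a, 'D_u f x = \sum_i fcoord i u *: 'D_(fvec i) f x.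
  by apply: filterS (smooth_near_nbhs sf) => x sx; exact: derive_frame (smooth_near_diff sx).
have dDf w : differentiable (fun x => 'D_w f x) a.
  exact: smooth_near_diff (smooth_near_derive w sf).
have dc (r : R) : differentiable (fun=> r) a by exact: differentiable_cst.
rewrite (near_eq_derive _ E) derive_sum_fun; last first.
  by move=> i; exact: differentiable_scale.
apply: eq_bigr => i _; rewrite (derive_scale v (dc _) (dDf _)).
by rewrite (derive_cst (fcoord i u)) scale0r add0r.
Qed.

(** The inner direction [X x] is frozen at the point [x] where the outer
    derivative is taken: this is the Hessian of [f] on two vector fields, and not
    an iterated derivative along fields. *)
Lemma along2_frame a X Y f : smooth_near a f ->
  \forall x \near a, \sum_i fcoord i (X x) *: 'D_(Y x) (fun z => 'D_(fvec i) f z) x =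
    'D_(Y x) (fun z => 'D_(X x) f z) x.
Proof.
by move=> sf; apply: filterS (smooth_near_nbhs sf) => x sx; rewrite -derive2_frame.
Qed.

Lemma smooth_near_coord a X i : smooth_near a X -> smooth_near a (fun x => fcoord i (X x)).
Proof. by apply: smooth_near_linear; exact: (@fcoord_cont _ _ fV i). Qed.

Lemma smooth_near_along2 a X Y f :
  smooth_near a X -> smooth_near a Y -> smooth_near a f ->
  smooth_near a (fun x => 'D_(Y x) (fun z => 'D_(X x) f z) x).
Proof.
move=> sX sY sf; apply: smooth_near_ext (along2_frame X Y sf) _.
apply: smooth_near_sum => i; apply: smooth_near_scale; first exact: smooth_near_coord.
by apply: smooth_near_along => //; exact: smooth_near_derive.
Qed.

(** Leibniz rule for the Hessian evaluated on two fields. *)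
Lemma derive_along2 a v X Y f :
  smooth_near a X -> smooth_near a Y -> smooth_near a f ->
  'D_v (fun x => 'D_(Y x) (fun z => 'D_(X x) f z) x) a =
  'D_v (fun x => 'D_(Y a) (fun z => 'D_(X a) f z) x) a +
  'D_('D_v Y a) (fun z => 'D_(X a) f z) a +
  'D_(Y a) (fun z => 'D_('D_v X a) f z) a.
Proof.
move=> sX sY sf; have dX := smooth_near_diff sX; have dY := smooth_near_diff sY.
have sD w : smooth_near a (fun x => 'D_w f x) := smooth_near_derive w sf.
have dYD i : differentiable (fun x => 'D_(Y x) (fun z => 'D_(fvec i) f z) x) a.
  exact: smooth_near_diff (smooth_near_along sY (sD _)).
have dYaD i : differentiable (fun x => 'D_(Y a) (fun z => 'D_(fvec i) f z) x) a.
  exact: smooth_near_diff (smooth_near_derive _ (sD _)).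
have dcX i : differentiable (fun x => fcoord i (X x)) a.
  exact: smooth_near_diff (smooth_near_coord i sX).
have dc (r : R) : differentiable (fun=> r) a by exact: differentiable_cst.
rewrite -(near_eq_derive _ (along2_frame X Y sf)).
rewrite -(near_eq_derive _ (along2_frame (fun=> X a) (fun=> Y a) sf)).
rewrite derive_sum_fun; last by move=> i; exact: differentiable_scale.
rewrite derive_sum_fun; last by move=> i; exact: differentiable_scale.
rewrite (derive2_frame _ _ sf) (derive2_frame _ _ sf) -!big_split /=.
apply: eq_bigr => i _.
rewrite (derive_scale v (dcX i) (dYD i)) (derive_scale v (dc _) (dYaD i)).
rewrite (derive_along _ dY (sD _)) (derive_cst (fcoord i (X a))) scale0r add0r.
by rewrite scalerDr addrC -(derive_linear_comp v (@fcoord_cont _ _ fV i) dX).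
Qed.

End SecondOrder.

Section VerticalDerivative.
Context {R : realType} {n : nat} {W : normedModType R}.
Local Notation E := 'rV[R]_n.
Implicit Types (a v : E * E) (w : E) (f : E * E -> W) (x y : E * E -> E).

(** The two factors of [E * E] carry the position and the velocity of a point of
    the slit tangent bundle, so this is a derivative along the fibre. *)
Definition vd w f : E * E -> W := fun a => 'D_((0, w) : E * E) f a.

Lemma smooth_near_vd a w f : smooth_near a f -> smooth_near a (vd w f).
Proof. exact: smooth_near_derive. Qed.

Lemma vd_comm {fW : framed W} a v w f : smooth_near a f ->
  'D_v (vd w f) a = vd w (fun b => 'D_v f b) a.
Proof. by move=> sf; exact: derive_comm. Qed.

Lemma vert_smooth a x : smooth_near a x -> smooth_near a (fun b => (0, x b) : E * E).
Proof. by move=> sx; apply: smooth_near_pair => //; exact: smooth_near_cst. Qed.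

Lemma derive_vert a v x : smooth_near a x ->
  'D_v (fun b => (0, x b) : E * E) a = (0, 'D_v x a).
Proof.
move=> sx; have d0 : differentiable (fun=> 0 : E) a by exact: differentiable_cst.
rewrite (derive_pair v d0 (smooth_near_diff sx)); congr pair; exact: derive_cst.
Qed.

Lemma smooth_vd_along a x f : smooth_near a x -> smooth_near a f ->
  smooth_near a (fun b => vd (x b) f b).
Proof. by move=> sx sf; apply: smooth_near_along => //; exact: vert_smooth. Qed.

Lemma derive_vd_along a v x f : smooth_near a x -> smooth_near a f ->
  'D_v (fun b => vd (x b) f b) a = 'D_v (vd (x a) f) a + vd ('D_v x a) f a.
Proof.
move=> sx sf; rewrite /vd (derive_along _ (smooth_near_diff (vert_smooth sx)) sf).
by rewrite derive_vert.
Qed.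

Lemma smooth_vd_along2 a x y f : smooth_near a x -> smooth_near a y -> smooth_near a f ->
  smooth_near a (fun b => vd (y b) (vd (x b) f) b).
Proof. by move=> sx sy sf; apply: smooth_near_along2 => //; exact: vert_smooth. Qed.

Lemma derive_vd_along2 a v x y f :
  smooth_near a x -> smooth_near a y -> smooth_near a f ->
  'D_v (fun b => vd (y b) (vd (x b) f) b) a =
  'D_v (vd (y a) (vd (x a) f)) a + vd ('D_v y a) (vd (x a) f) a +
  vd (y a) (vd ('D_v x a) f) a.
Proof.
move=> sx sy sf.
apply: etrans (derive_along2 v (vert_smooth sx) (vert_smooth sy) sf) _.
by rewrite (derive_vert v sx) (derive_vert v sy).
Qed.

End VerticalDerivative.

(** * The Berwald connection and its curvature in coordinates *)

Section BerwaldCalculus.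
Context {R : realType} {n : nat}.
Local Notation E := 'rV[R]_n.
Variables (F : E * E -> E) (a : E * E).
Hypothesis sF : smooth_near a F.
Implicit Types (A : E * E -> E * E) (x y : E * E -> E) (c : E * E).

(** [(x, - vd x F)] is the horizontal lift of [x] for the nonlinear connection
    with coefficients [vd _ F]. *)
Lemma derive_horizontal c x : smooth_near a x ->
  'D_c (fun b => (x b, - vd (x b) F b)) a =
  ('D_c x a, - ('D_c (vd (x a) F) a + vd ('D_c x a) F a)).
Proof.
move=> sx; have dv := smooth_near_diff (smooth_vd_along sx sF).
apply: etrans (derive_pair c (smooth_near_diff sx) (smooth_near_diff (smooth_nearN (smooth_vd_along sx sF)))) _.
apply/pair_equal_spec; split; first exact: erefl.
have eN : 'D_c (fun b => - vd (x b) F b) a = - 'D_c (fun b => vd (x b) F b) a.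
  exact: derive_opp dv.
apply: etrans eN _.
by congr (- _); exact: derive_vd_along.
Qed.

Lemma vd_sub0 w : vd (0 - w) F a = - vd w F a.
Proof.
have e : (0, 0 - w) = - (0, w) :> E * E.
  by apply/pair_equal_spec; split; rewrite ?oppr0 ?sub0r.
by rewrite /vd e derive_dirN//; exact: smooth_near_diff.
Qed.

Lemma berwald_cancel {W : zmodType} (p q r s : W) : p - 0 + (q - (- (r + s)) - s) = p + q + r.
Proof. by rewrite subr0 opprK (addrA q) addrK (addrA p). Qed.

(** With [x] the first component of [A], the left side is the expression in
    coordinates of rho [gamma (K X), beta Y] + K [beta (rho X), gamma Y].  The
    derivatives of [x] cancel because K adds [vd w.1 F] to the second component of
    the bracket [w], and the directions [(0, k)] and [(x, - vd x F)] of the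
    derivatives of [y] add up to [A]. *)
Lemma berwald_calc A y : smooth_near a A -> smooth_near a y ->
  let k b := (A b).2 + vd (A b).1 F b in
  let w := 'D_((A a).1, - vd (A a).1 F a) (fun b => (0, y b)) a
           - 'D_(0, y a) (fun b => ((A b).1, - vd (A b).1 F b)) a : E * E in
  ('D_(0, k a) (fun b => (y b, - vd (y b) F b)) a
    - 'D_(y a, - vd (y a) F a) (fun b => (0, k b)) a).1 + (w.2 + vd w.1 F a) =
  'D_(A a) y a + vd (y a) (vd (A a).1 F) a.
Proof.
move=> sA sy k w.
have sx : smooth_near a (fun b => (A b).1) := smooth_near_fst sA.
have sk : smooth_near a k.
  by apply: smooth_nearD; [exact: smooth_near_snd|exact: smooth_vd_along].
have e1 := congr2 (fun s t : E * E => (s - t).1) (derive_horizontal (0, k a) sy)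
  (derive_vert (y a, - vd (y a) F a) sk).
have ew : w = _ := congr2 (fun s t : E * E => s - t)
  (derive_vert ((A a).1, - vd (A a).1 F a) sy) (derive_horizontal (0, y a) sx).
rewrite ew; apply: etrans (congr1 (fun t => t + _) e1) _.
apply: etrans (congr1 (fun t => _ + (_ + t)) (vd_sub0 _)) _.
apply: etrans (berwald_cancel _ _ _ _) _.
congr (_ + _).
apply: etrans (esym (derive_dirD _ _ (smooth_near_diff sy))) _.
congr ('D_ _ _ _); rewrite [RHS]surjective_pairing; apply/pair_equal_spec; split.
  exact: add0r.
by rewrite /k /= addrK.
Qed.

End BerwaldCalculus.

Section CurvatureCalculus.
Context {R : realType} {n : nat}.
Local Notation E := 'rV[R]_n.
Variables (F : E * E -> E) (a : E * E).
Hypothesis sF : smooth_near a F.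
Implicit Types (x y z : E * E -> E) (c : E * E).

Lemma vd0 {W : normedModType R} (f : E * E -> W) b : vd 0 f b = 0.
Proof. exact: derive0. Qed.

Lemma vd_vd0 w b : vd w (vd 0 F) b = 0.
Proof.
have -> : vd 0 F = fun=> 0 :> E by apply/funext => d; exact: vd0.
exact: derive_cst.
Qed.

Lemma vd2_sub0 (z w : E) : vd z (vd (0 - w) F) a = - vd z (vd w F) a.
Proof.
have e : \forall b \near a, vd (0 - w) F b = - vd w F b.
  by apply: filterS (smooth_near_nbhs sF) => b sb; exact: vd_sub0.
apply: etrans (near_eq_derive _ e) _.
exact: derive_opp (smooth_near_diff (smooth_near_vd w sF)).
Qed.

Lemma curvature_cancel (s1 s2 s3 v1 v2 p : E) :
  - (s1 + s2 + v1) + (s1 + s3 + (p + v1 + v2)) + (s2 - s3 + - v2) = p.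
Proof. by apply/rowP => i; rewrite !mxE; ring. Qed.

(** The Berwald derivative of [z] along [A] is
    ['D_A z + vd z (vd A.1 F)].  In the curvature of the lifts [B] and [D] the
    second derivatives of [z] cancel by symmetry, those of first order against the
    bracket [w], and of the connection form [vd z (vd x F)] only its derivative
    along the fibre remains. *)
Lemma curvature_calc x y z : smooth_near a x -> smooth_near a y -> smooth_near a z ->
  let B b := (x b, - vd (x b) F b) : E * E in
  let D b := (0, y b) : E * E in
  let q1 b := 'D_(D b) z b in
  let q2 b := 'D_(B b) z b + vd (z b) (vd (x b) F) b in
  let w := 'D_(B a) D a - 'D_(D a) B a in
  - ('D_(B a) q1 a + vd (q1 a) (vd (x a) F) a) + 'D_(D a) q2 a
  + ('D_w z a + vd (z a) (vd w.1 F) a) =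
  vd (y a) (vd (z a) (vd (x a) F)) a.
Proof.
move=> sx sy sz B D q1 q2 w.
have sD : smooth_near a D := vert_smooth sy.
have sB : smooth_near a B.
  by apply: smooth_near_pair => //; apply: smooth_nearN; exact: smooth_vd_along.
have sBz : smooth_near a (fun b => 'D_(B b) z b) by exact: smooth_near_along.
have szx := smooth_vd_along2 sx sz sF.
have e1 : 'D_(B a) q1 a = 'D_(B a) (fun b => 'D_(D a) z b) a + 'D_('D_(B a) D a) z a.
  exact: derive_along (smooth_near_diff sD) sz.
have e2 : 'D_(D a) q2 a = 'D_(D a) (fun b => 'D_(B b) z b) a +
    'D_(D a) (fun b => vd (z b) (vd (x b) F) b) a.
  exact: deriveD (diff_derivable (smooth_near_diff sBz)) (diff_derivable (smooth_near_diff szx)).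
have e3 : 'D_(D a) (fun b => 'D_(B b) z b) a =
    'D_(B a) (fun b => 'D_(D a) z b) a + 'D_('D_(D a) B a) z a.
  apply: etrans (derive_along _ (smooth_near_diff sB) sz) _.
  exact (congr1 (fun t => t + 'D_('D_(D a) B a) z a) (derive_comm (B a) (D a) sz)).
have e4 := derive_vd_along2 (D a) sx sz sF.
have e5 : 'D_w z a = 'D_('D_(B a) D a) z a - 'D_('D_(D a) B a) z a.
  exact: derive_dirB (smooth_near_diff sz).
have e6 : vd (z a) (vd w.1 F) a = - vd (z a) (vd ('D_(D a) x a) F) a.
  have -> : w.1 = 0 - 'D_(D a) x a.
    exact (congr2 (fun s t : E * E => (s - t).1) (derive_vert (B a) sy) (derive_horizontal sF (D a) sx)).
  exact: vd2_sub0.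
apply: etrans (congr2 (fun s t => s + t) (congr2 (fun s t => - (s + _) + t) e1
  (etrans e2 (congr2 (fun s t => s + t) e3 e4))) (congr2 (fun s t => s + t) e5 e6)) _.
exact: curvature_cancel.
Qed.

End CurvatureCalculus.

(** * Traces and vertical divergence *)

Section MatrixOf.
Context {R : realType} {n : nat}.
Local Notation E := 'rV[R]_n.
Implicit Types f g : E -> E.

Definition mx_of f : 'M[R]_n := \matrix_i f (delta_mx 0 i).

Lemma mul_mx_of f (w : E) : linear f -> w *m mx_of f = f w.
Proof.
move=> lf; pose fM := GRing.isLinear.Build _ _ _ _ f lf.
pose fL : {linear _ -> _} := HB.pack f fM.
have <- : fL w = f w by [].
by rewrite -mul_rV_lin1; congr (_ *m _); apply/matrixP => i j; rewrite !mxE.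
Qed.

Lemma eq_mx_of f (B : 'M[R]_n) : (forall w, w *m B = f w) -> B = mx_of f.
Proof. by move=> h; apply/row_matrixP => i; rewrite rowE h rowK. Qed.

(** Cyclicity of the trace; [g] and [h] are the changes between two charts. *)
Lemma tr_mx_of_conj f g h : linear f -> linear g -> linear h ->
  (forall w, h (g w) = w) -> \tr (mx_of (fun w => g (f (h w)))) = \tr (mx_of f).
Proof.
move=> lf lg lh hg.
have <- : mx_of h *m mx_of f *m mx_of g = mx_of (fun w => g (f (h w))).
  by apply: eq_mx_of => w; rewrite !mulmxA !mul_mx_of.
rewrite mxtrace_mulC mulmxA (_ : mx_of g *m mx_of h = 1%:M) ?mul1mx//.
by apply/row_matrixP => i; rewrite rowE mulmxA !mul_mx_of// hg -row1 // rowE mulmx1.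
Qed.

End MatrixOf.

Section Trace.
Context {R : realType} {n : nat}.
Local Notation E := 'rV[R]_n.
Variable F : E * E -> E.

(** Divergence along the fibre. *)
Definition vdiv (b : E * E) : R := \sum_i row_coord i (vd (delta_mx 0 i) F b).

Lemma smooth_vdiv a : smooth_near a F -> smooth_near a vdiv.
Proof.
move=> sF; apply: smooth_near_sum => i.
exact: smooth_near_linear (@row_coord_cont R n i) (smooth_near_vd _ sF).
Qed.

Lemma derive_sum_coord a c (f : 'I_n -> E * E -> E) : (forall i, smooth_near a (f i)) ->
  'D_c (fun b => \sum_i row_coord i (f i b)) a = \sum_i row_coord i ('D_c (f i) a).
Proof.
move=> sf.
have sc i : smooth_near a (fun b => row_coord i (f i b)).
  exact: smooth_near_linear (@row_coord_cont R n i) (sf i).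
apply: etrans (derive_sum_fun c (fun i => smooth_near_diff (sc i))) _.
apply: eq_bigr => i _.
exact: derive_linear_comp (@row_coord_cont R n i) (smooth_near_diff (sf i)).
Qed.

(** Derivatives commute with one another and with the trace, so a trace of third
    derivatives of [F] is a second derivative of one scalar function. *)
Lemma vd2_vdiv a (x y : E) : smooth_near a F ->
  vd y (vd x vdiv) a = \sum_i row_coord i (vd y (vd (delta_mx 0 i) (vd x F)) a).
Proof.
move=> sF.
have e : \forall b \near a, vd x vdiv b =
    \sum_i row_coord i (vd (delta_mx 0 i) (vd x F) b).
  apply: filterS (smooth_near_nbhs sF) => b sb.
  apply: etrans (derive_sum_coord _ (fun i => smooth_near_vd (delta_mx 0 i) sb)) _.
  exact (eq_bigr _ (fun i _ => congr1 (row_coord i) (vd_comm (0, x) (delta_mx 0 i) sb))).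
apply: etrans (near_eq_derive _ e) _.
exact: derive_sum_coord (fun i => smooth_near_vd (delta_mx 0 i) (smooth_near_vd x sF)).
Qed.

(** After an exchange of the derivatives, [w] is the outer direction, in which the
    derivative is linear. *)
Lemma vd2_linear a (y : E) (H : E * E -> E) : smooth_near a H ->
  linear (fun w => vd y (vd w H) a).
Proof.
move=> sH k w w'.
have sy : differentiable (vd y H) a := smooth_near_diff (smooth_near_vd y sH).
have e t : vd y (vd t H) a = vd t (vd y H) a by exact (vd_comm (0, y) t sH).
have ev : (0, k *: w + w') = k *: (0, w) + (0, w') :> E * E.
  by apply/pair_equal_spec; split=> //=; rewrite ?scaler0 ?addr0.
have ez : 'D_(k *: (0, w)) (vd y H) a = k *: vd y (vd w H) a.
  exact (etrans (derive_dirZ k (0, w) sy) (congr1 (fun t => k *: t) (esym (e w)))).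
apply: etrans (e _) _; apply: etrans (congr1 (fun c => 'D_c (vd y H) a) ev) _.
apply: etrans (derive_dirD _ _ sy) _.
exact (congr2 (fun s t => s + t) ez (esym (e w'))).
Qed.

End Trace.

(** * Projective change of the spray coefficients *)

Section EulerHomogeneity.
Context {R : realType} {n : nat}.
Local Notation E := 'rV[R]_n.

(** Euler's identity: the difference quotient along the ray of [b] is constant. *)
Lemma vd_homogeneous1 (f : E * E -> R) (b : E * E) :
  (forall t : R, 0 < t -> f (b.1, t *: b.2) = t * f b) -> vd b.2 f b = f b.
Proof.
move=> fh; apply/lim_near_cst => //=; near=> t.
have t0 : t != 0 by near: t; exact: nbhs_dnbhs_neq.
have t1 : 0 < 1 + t.
  have : `|t| < 1 by near: t; apply: dnbhs0_lt.
  by rewrite ltr_norml => /andP[h _]; rewrite addrC -ltrBlDr sub0r.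
(* The point reached by the increment is [b] with velocity scaled by [1 + t]. *)
have -> : t *: (0, b.2) + b = (b.1, (1 + t) *: b.2) :> E * E.
  case: b {fh} => b1 b2; apply/pair_equal_spec; split; rewrite /= ?scaler0 ?add0r//.
  by rewrite scalerDl scale1r addrC.
rewrite fh// mulrDl mul1r addrC addKr.
by apply: etrans (mulKf t0 (f b)).
Unshelve. all: by end_near. Qed.

End EulerHomogeneity.

Section AffineCalculus.
Context {R : realType} {n : nat}.
Local Notation E := 'rV[R]_n.
Implicit Types (a b : E * E) (w : E).

Lemma vd_add {W : normedModType R} a w (f g : E * E -> W) :
  smooth_near a f -> smooth_near a g ->
  vd w (fun b => f b + g b) a = vd w f a + vd w g a.
Proof.
move=> sf sg.
exact (deriveD (@diff_derivable _ _ _ _ _ (0, w) (smooth_near_diff sf))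
  (@diff_derivable _ _ _ _ _ (0, w) (smooth_near_diff sg))).
Qed.

Lemma vd_scale {W : normedModType R} a w (k : E * E -> R) (f : E * E -> W) :
  smooth_near a k -> smooth_near a f ->
  vd w (fun b => k b *: f b) a = vd w k a *: f a + k a *: vd w f a.
Proof.
by move=> sk sf; exact (derive_scale (0, w) (smooth_near_diff sk) (smooth_near_diff sf)).
Qed.

Lemma vdZ {W : normedModType R} a w (k : R) (f : E * E -> W) : smooth_near a f ->
  vd w (fun b => k *: f b) a = k *: vd w f a.
Proof.
move=> sf; exact (deriveZ k (@diff_derivable _ _ _ _ _ (0, w) (smooth_near_diff sf))).
Qed.

Lemma vd_cst {W : normedModType R} a w (c : W) : vd w (fun=> c) a = 0.
Proof. exact: derive_cst. Qed.

Lemma vd_scale_cst {W : normedModType R} a w (k : E * E -> R) (c : W) :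
  smooth_near a k -> vd w (fun b => k b *: c) a = vd w k a *: c.
Proof.
move=> sk; apply: etrans (vd_scale w sk (smooth_near_cst a c)) _.
by rewrite vd_cst scaler0 addr0.
Qed.

Lemma smooth_snd a : smooth_near a (fun b : E * E => b.2).
Proof. exact: smooth_near_snd (smooth_near_id a). Qed.

Lemma vd_snd a w : vd w (fun b : E * E => b.2) a = w.
Proof.
apply: etrans (derive_snd _ (smooth_near_diff (smooth_near_id a))) _.
by rewrite derive_id.
Qed.

Lemma vd_near_eq {W : normedModType R} a w (f g : E * E -> W) :
  (\forall b \near a, f b = g b) -> \forall b \near a, vd w f b = vd w g b.
Proof.
by move=> /nbhs_interior; apply: filterS => b e; exact: near_eq_derive e.
Qed.

Lemma vd_affine a w (f h c : E * E -> E) (k : E * E -> R) :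
  smooth_near a h -> smooth_near a c -> smooth_near a k ->
  (\forall b \near a, f b = h b + (k b *: b.2 + c b)) ->
  vd w f a = vd w h a + (vd w k a *: a.2 + (k a *: w + vd w c a)).
Proof.
move=> sh sc sk e; have sky := smooth_near_scale sk (smooth_snd a).
apply: etrans (near_eq_derive _ e) _.
apply: etrans (vd_add w sh (smooth_nearD sky sc)) _.
apply: etrans (congr1 (fun t => _ + t) (vd_add w sky sc)) _.
apply: etrans (congr1 (fun t => _ + (t + _)) (vd_scale w sk (smooth_snd a))) _.
apply: etrans (congr1 (fun t => _ + (_ + _ *: t + _)) (vd_snd a w)) _.
exact (congr1 (fun t => _ + t) (esym (addrA _ _ _))).
Qed.

Lemma near_vd_affine a w (f h c : E * E -> E) (k : E * E -> R) :
  smooth_near a h -> smooth_near a c -> smooth_near a k ->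
  (\forall b \near a, f b = h b + (k b *: b.2 + c b)) ->
  \forall b \near a, vd w f b = vd w h b + (vd w k b *: b.2 + (k b *: w + vd w c b)).
Proof.
move=> /smooth_near_nbhs sh /smooth_near_nbhs sc /smooth_near_nbhs sk /nbhs_interior e.
apply: filterS3 (filterI sh sc) sk e => b [hb cb] kb eb.
exact: vd_affine.
Qed.

Lemma near_vd_addZ {W : normedModType R} a w (f g h : E * E -> W) (k : R) :
  smooth_near a g -> smooth_near a h ->
  (\forall b \near a, f b = g b + k *: h b) ->
  \forall b \near a, vd w f b = vd w g b + k *: vd w h b.
Proof.
move=> sg sh /(vd_near_eq w) e.
apply: filterS3 (smooth_near_nbhs sg) (smooth_near_nbhs sh) e => b bg bh ->.
exact (etrans (vd_add w bg (smooth_nearZ _ bh)) (congr1 (fun t => _ + t) (vdZ w _ bh))).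
Qed.

(** The components of the Douglas tensor at the point with coordinates [a], for
    the spray with components [(y, - 2 F)]. *)
Definition local_douglas (F : E * E -> E) a (x y z : E) : E :=
  vd y (vd z (vd x F)) a
  - n.+1%:R^-1 *: (vd y (vd x (vdiv F)) a *: z + vd z (vd y (vdiv F)) a *: x
                   + vd x (vd z (vdiv F)) a *: y)
  - n.+1%:R^-1 *: (vd y (vd z (vd x (vdiv F))) a *: a.2).

Section Projective.
Variables (a : E * E) (F F' : E * E -> E) (l : E * E -> R).
Hypotheses (sF : smooth_near a F) (sl : smooth_near a l).
Hypothesis eF : \forall b \near a, F' b = F b + l b *: b.2.
Hypothesis euler_l : \forall b \near a, vd b.2 l b = l b.

Lemma near_projective : \forall b \near a, F' b = F b + (l b *: b.2 + 0).
Proof. by apply: filterS eF => b ->; rewrite addr0. Qed.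

Lemma near_vd_projective w :
  \forall b \near a, vd w F' b = vd w F b + (vd w l b *: b.2 + l b *: w).
Proof.
apply: filterS (near_vd_affine w sF (smooth_near_cst a 0) sl near_projective) => b ->.
by rewrite vd_cst addr0.
Qed.

Lemma near_vd2_projective w z :
  \forall b \near a, vd z (vd w F') b =
    vd z (vd w F) b + (vd z (vd w l) b *: b.2 + (vd w l b *: z + vd z l b *: w)).
Proof.
have sc : smooth_near a (fun b => l b *: w).
  exact: smooth_near_scale sl (smooth_near_cst a w).
apply: filterS2 (smooth_near_nbhs sl) (near_vd_affine z (smooth_near_vd w sF) sc
  (smooth_near_vd w sl) (near_vd_projective w)) => b lb ->.
by rewrite vd_scale_cst.
Qed.

Lemma vd3_projective w z t :
  vd t (vd z (vd w F')) a = vd t (vd z (vd w F)) a +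
   (vd t (vd z (vd w l)) a *: a.2 + (vd z (vd w l) a *: t +
     (vd t (vd w l) a *: z + vd t (vd z l) a *: w))).
Proof.
have swl := smooth_near_vd w sl; have szl := smooth_near_vd z sl.
have s1 : smooth_near a (fun b => vd w l b *: z).
  exact: smooth_near_scale swl (smooth_near_cst a z).
have s2 : smooth_near a (fun b => vd z l b *: w).
  exact: smooth_near_scale szl (smooth_near_cst a w).
apply: etrans (vd_affine t (smooth_near_vd z (smooth_near_vd w sF)) (smooth_nearD s1 s2)
  (smooth_near_vd z swl) (near_vd2_projective w z)) _.
apply: congr1; apply: congr1; apply: congr1.
apply: etrans (vd_add t s1 s2) _.
exact (congr2 (fun x y => x + y) (vd_scale_cst t z swl) (vd_scale_cst t w szl)).
Qed.

Lemma vd_frame (f : E * E -> R) b y : differentiable f b ->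
  vd y f b = \sum_i row_coord i y * vd (delta_mx 0 i) f b.
Proof.
move=> df; rewrite /vd.
have e : (0, y) = \sum_i row_coord i y *: (0, delta_mx 0 i) :> E * E.
  rewrite [RHS]surjective_pairing.
  rewrite (big_morph fst (id1 := 0) (op1 := +%R))// (big_morph snd (id1 := 0) (op1 := +%R))//.
  apply/pair_equal_spec; split; last exact: row_coordE.
  by rewrite big1// => i _; rewrite /= scaler0.
rewrite e (derive_dir_sum _ df); apply: eq_bigr => i _.
exact: derive_dirZ.
Qed.

(** The divergence of [l y] is [vd y l + n l], which is [(n + 1) l] by Euler's
    identity for [l]: this is the origin of the factor [n + 1] in the Douglas
    tensor. *)
Lemma near_vdiv_projective :
  \forall b \near a, vdiv F' b = vdiv F b + n.+1%:R *: l b.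
Proof.
have nF := nbhs_interior eF.
have n1 : \forall b \near a, [/\ smooth_near b F, smooth_near b l & vd b.2 l b = l b].
  exact: filterS3 (smooth_near_nbhs sF) (smooth_near_nbhs sl) euler_l.
apply: filterS2 n1 nF => b [bF bl bh] be.
have e (i : 'I_n) : row_coord i (vd (delta_mx 0 i) F' b) =
    row_coord i (vd (delta_mx 0 i) F b) +
    (row_coord i b.2 * vd (delta_mx 0 i) l b + l b).
  have be' : \forall c \near b, F' c = F c + (l c *: c.2 + 0).
    by apply: filterS be => c ->; rewrite addr0.
  rewrite (vd_affine (delta_mx 0 i) bF (smooth_near_cst b 0) bl be') vd_cst addr0.
  by rewrite /row_coord !mxE !eqxx mulr1 [X in _ + (X + _) = _]mulrC.
rewrite /vdiv (eq_bigr _ (fun i _ => e i)) big_split /=; congr (_ + _).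
rewrite big_split /= -vd_frame ?bh; last exact: smooth_near_diff.
by rewrite sumr_const card_ord scaler_nat mulrS.
Qed.

Let c : R := n.+1%:R.

Lemma near_vd_vdiv_projective w :
  \forall b \near a, vd w (vdiv F') b = vd w (vdiv F) b + c *: vd w l b.
Proof. exact: near_vd_addZ (smooth_vdiv sF) sl near_vdiv_projective. Qed.

Lemma near_vd2_vdiv_projective w z :
  \forall b \near a, vd z (vd w (vdiv F')) b =
    vd z (vd w (vdiv F)) b + c *: vd z (vd w l) b.
Proof.
exact: near_vd_addZ (smooth_near_vd w (smooth_vdiv sF)) (smooth_near_vd w sl)
  (near_vd_vdiv_projective w).
Qed.

Lemma near_vd3_vdiv_projective w z t :
  \forall b \near a, vd t (vd z (vd w (vdiv F'))) b =
    vd t (vd z (vd w (vdiv F))) b + c *: vd t (vd z (vd w l)) b.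
Proof.
exact: near_vd_addZ (smooth_near_vd z (smooth_near_vd w (smooth_vdiv sF)))
  (smooth_near_vd z (smooth_near_vd w sl)) (near_vd2_vdiv_projective w z).
Qed.

Lemma douglas_cancel (k L3 Lzx Lyx Lzy Syx Szy Sxz S3 : R) (T x y z e : E) : k != 0 ->
  T + (L3 *: e + (Lzx *: y + (Lyx *: z + Lzy *: x)))
  - k^-1 *: ((Syx + k *: Lyx) *: z + (Szy + k *: Lzy) *: x + (Sxz + k *: Lzx) *: y)
  - k^-1 *: ((S3 + k *: L3) *: e) =
  T - k^-1 *: (Syx *: z + Szy *: x + Sxz *: y) - k^-1 *: (S3 *: e).
Proof.
move=> k0; have sE (p q : R) : p *: q = p * q by [].
by apply/rowP => i; rewrite !mxE !sE; field.
Qed.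

(** The third derivative of [l y] is the third derivative of [l] times [y], plus
    the three second derivatives of [l] times the remaining vector.  The traces
    change by [n + 1] times these derivatives of [l], so the last two terms of the
    Douglas tensor undo exactly this change. *)
Lemma local_douglas_projective x y z : local_douglas F' a x y z = local_douglas F a x y z.
Proof.
have cyz : vd y (vd z l) a = vd z (vd y l) a.
  exact: derive_comm_scalar.
have cxz : vd x (vd z l) a = vd z (vd x l) a.
  exact: derive_comm_scalar.
have eT := etrans (vd3_projective x z y)
  (congr1 (fun t => _ + (_ + (_ + (_ + t *: x)))) cyz).
have eyx := nbhs_singleton (near_vd2_vdiv_projective x y).
have ezy := nbhs_singleton (near_vd2_vdiv_projective y z).
have exz := etrans (nbhs_singleton (near_vd2_vdiv_projective z x))
  (congr1 (fun t => _ + c *: t) cxz).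
have e3 := nbhs_singleton (near_vd3_vdiv_projective x z y).
pose D (T : E) (p q r s : R) :=
  T - c^-1 *: (p *: z + q *: x + r *: y) - c^-1 *: (s *: a.2).
have c0 : c != 0 by rewrite pnatr_eq0.
exact (etrans (f_equal5 D eT eyx ezy exz e3) (douglas_cancel _ _ _ _ _ _ _ _ _ _ _ _ _ c0)).
Qed.

End Projective.
End AffineCalculus.

(** * Atlases *)

Section Atlas.
Context {R : realType} {E : normedModType R} {fE : framed E}.

Definition chart_map (N : charted E) (x y : N) : E -> E :=
  crd (chart_at y) \o par (chart_at x).

(** The facts on charts that hold for a manifold and for its slit tangent bundle
    alike.  [atlas_overlap] combines that overlaps of charts are open and that
    [crd] is a left inverse of [par]. *)
Record atlas (N : charted E) : Prop := Atlas {
  atlas_dom : forall x : N, dom (chart_at x) x;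
  atlas_parK : forall x z : N, dom (chart_at x) z ->
    par (chart_at x) (crd (chart_at x) z) = z;
  atlas_overlap : forall x y z : N, dom (chart_at x) z -> dom (chart_at y) z ->
    \forall a \near crd (chart_at x) z,
      [/\ dom (chart_at x) (par (chart_at x) a),
          dom (chart_at y) (par (chart_at x) a)
        & crd (chart_at x) (par (chart_at x) a) = a];
  atlas_smooth : forall x y z : N, dom (chart_at x) z -> dom (chart_at y) z ->
    smooth_near (crd (chart_at x) z) (chart_map x y)
}.

Context {N : charted E} (AN : atlas N).
Implicit Types x z : N.

Local Notation φ x := (crd (chart_at x)).
Local Notation par_ x := (par (chart_at x)).
Local Notation dom_ x := (dom (chart_at x)).

Definition local_field x (X : vfield N) : E -> E := fun a => dir (X (par_ x a)) (φ x).

Lemma local_fieldK x z X : dom_ x z -> local_field x X (φ x z) = dir (X z) (φ x).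
Proof. by move=> xz; rewrite /local_field (atlas_parK AN xz). Qed.

Lemma chart_map_crd x y z : dom_ x z -> chart_map x y (φ x z) = φ y z.
Proof. by move=> xz; rewrite /chart_map /= (atlas_parK AN xz). Qed.

Lemma near_chart x z : dom_ x z ->
  \forall a \near φ x z, dom_ x (par_ x a) /\ φ x (par_ x a) = a.
Proof.
by move=> xz; apply: filterS (atlas_overlap AN xz xz) => a [].
Qed.

(** The preferred charts at [z] and at [x] differ by a transition map, so this is
    the chain rule.  It brings all computations near a point into one chart. *)
Lemma dir_chart {W : normedModType R} x z (v : tangent z) (f : N -> W) :
  dom_ x z -> differentiable (f \o par_ x) (φ x z) ->
  dir v f = 'D_(dir v (φ x)) (f \o par_ x) (φ x z).
Proof.
move=> xz df; have zz := atlas_dom AN z.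
have dT := smooth_near_diff (atlas_smooth AN zz xz).
have Ez := chart_map_crd x zz.
rewrite /dir -(derive_chain_at _ Ez dT df).
apply: near_eq_derive; apply: filterS (atlas_overlap AN zz xz) => a [_ xa _].
by rewrite /chart_map /= (atlas_parK AN xa).
Qed.

Lemma dir_crd z (v : tangent z) : dir v (φ z) = v.
Proof.
rewrite /dir (near_eq_derive (g := id)) ?derive_id//.
by apply: filterS (near_chart (atlas_dom AN z)) => a [].
Qed.

Lemma dir_crdK x z (v : tangent z) : dom_ x z ->
  'D_(dir v (φ x)) (chart_map x z) (φ x z) = v.
Proof.
move=> xz; rewrite -dir_chart ?dir_crd//.
exact: smooth_near_diff (atlas_smooth AN xz (atlas_dom AN z)).
Qed.

Lemma dir_inj x z (v w : tangent z) : dom_ x z ->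
  dir v (φ x) = dir w (φ x) -> v = w.
Proof. by move=> xz e; rewrite -(dir_crdK v xz) e dir_crdK. Qed.

(** The field with constant components [w] in the chart at [x]. *)
Definition cst_field x (w : E) : vfield N := fun z => 'D_w (chart_map x z) (φ x z).

Lemma dir_cst_field x z w : dom_ x z -> dir (cst_field x w z) (φ x) = w.
Proof.
move=> xz; have zz := atlas_dom AN z.
have dT := smooth_near_diff (atlas_smooth AN xz zz).
have dT' := smooth_near_diff (atlas_smooth AN zz xz).
have Ez := chart_map_crd z xz.
rewrite /dir /cst_field -/(chart_map z x) -(derive_chain_at _ Ez dT dT').
rewrite (near_eq_derive (g := id)) ?derive_id//.
apply: filterS (atlas_overlap AN xz zz) => a [xa za e].
by rewrite /chart_map /= (atlas_parK AN za) e.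
Qed.

Lemma cst_fieldE x w : cst_field x w x = w.
Proof.
have xx := atlas_dom AN x.
by apply: (dir_inj xx); rewrite (dir_cst_field w xx) [RHS]dir_crd.
Qed.

Lemma dirD x z (v w : tangent z) : dom_ x z ->
  dir (v + w : tangent z) (φ x) = dir v (φ x) + dir w (φ x).
Proof.
move=> xz; apply: derive_dirD.
exact: smooth_near_diff (atlas_smooth AN (atlas_dom AN z) xz).
Qed.

Lemma dirZ x z k (v : tangent z) : dom_ x z ->
  dir (k *: v : tangent z) (φ x) = k *: dir v (φ x).
Proof.
move=> xz; apply: derive_dirZ.
exact: smooth_near_diff (atlas_smooth AN (atlas_dom AN z) xz).
Qed.

Lemma dirN x z (v : tangent z) : dom_ x z ->
  dir (- v : tangent z) (φ x) = - dir v (φ x).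
Proof.
move=> xz; apply: derive_dirN.
exact: smooth_near_diff (atlas_smooth AN (atlas_dom AN z) xz).
Qed.

Lemma dirB x z (v w : tangent z) : dom_ x z ->
  dir (v - w : tangent z) (φ x) = dir v (φ x) - dir w (φ x).
Proof.
move=> xz; apply: derive_dirB.
exact: smooth_near_diff (atlas_smooth AN (atlas_dom AN z) xz).
Qed.

Lemma smooth_at_chart {W : normedModType R} x z (f : N -> W) :
  dom_ x z -> smooth_at N z f -> smooth_near (φ x z) (f \o par_ x).
Proof.
move=> xz sf; have zz := atlas_dom AN z.
have Ez := chart_map_crd z xz.
have sf' : smooth_near (chart_map x z (φ x z)) (f \o par_ z) by rewrite Ez.
apply: smooth_near_ext (smooth_near_comp (atlas_smooth AN xz zz) sf').
apply: filterS (atlas_overlap AN xz zz) => a [xa za e].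
by rewrite /chart_map /= (atlas_parK AN za).
Qed.

(** The components change by the derivative of the transition map, taken along the
    components themselves. *)
Lemma smooth_local_field x z (X : vfield N) : dom_ x z ->
  vfield_smooth_at z X -> smooth_near (φ x z) (local_field x X).
Proof.
move=> xz sX; have zz := atlas_dom AN z.
have sT := atlas_smooth AN xz zz; have sT' := atlas_smooth AN zz xz.
have Ez := chart_map_crd z xz.
have s : smooth_near (chart_map x z (φ x z))
    (fun b => 'D_(local_field z X b) (chart_map z x) b).
  by rewrite Ez; apply: smooth_near_along.
apply: smooth_near_ext (smooth_near_comp sT s).
have n1 := atlas_overlap AN xz zz.
have n2 : \forall a \near φ x z, smooth_near (chart_map x z a) (chart_map z x).
  have /(differentiable_continuous (smooth_near_diff sT)) : nbhs (chart_map x z (φ x z))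
     (fun b => smooth_near b (chart_map z x)) by rewrite Ez; exact: smooth_near_nbhs.
  exact.
apply: filterS2 n1 n2 => a [xa za e] sa.
rewrite /chart_map /= local_fieldK//.
by apply/esym/(@dir_chart _ z) => //; exact: smooth_near_diff.
Qed.

Lemma local_cst_field x z w : dom_ x z ->
  \forall a \near φ x z, local_field x (cst_field x w) a = w.
Proof. by move=> xz; apply: filterS (near_chart xz) => a [xa _]; exact: dir_cst_field. Qed.

Lemma smooth_cst_field x w : vfield_smooth_at x (cst_field x w).
Proof.
suff : smooth_near (φ x x) (local_field x (cst_field x w)) by [].
apply: smooth_near_ext (smooth_near_cst _ w).
by apply: filterS (local_cst_field w (atlas_dom AN x)) => a /esym.
Qed.

(** The bracket at [z] refers to the preferred chart at [z].  Written with the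
    transition from the chart at [x], it has in addition the second derivative of
    the transition on the two fields, which is symmetric and cancels. *)
Lemma local_bracket x z (X Y : vfield N) : dom_ x z ->
  smooth_near (φ x z) (local_field x X) -> smooth_near (φ x z) (local_field x Y) ->
  dir (bracket X Y z) (φ x) =
  'D_(dir (X z) (φ x)) (local_field x Y) (φ x z) -
  'D_(dir (Y z) (φ x)) (local_field x X) (φ x z).
Proof.
move=> xz sX sY; have zz := atlas_dom AN z.
have sT := atlas_smooth AN xz zz; have dT := smooth_near_diff sT.
have key (A B : vfield N) : smooth_near (φ x z) (local_field x A) ->
    smooth_near (φ x z) (local_field x B) ->
    act A (act B (φ z)) z =
    'D_(dir (A z) (φ x)) (fun a => 'D_(dir (B z) (φ x)) (chart_map x z) a) (φ x z) +
    'D_('D_(dir (A z) (φ x)) (local_field x B) (φ x z)) (chart_map x z) (φ x z).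
  move=> sA sB.
  have eB : \forall a \near φ x z,
      'D_(local_field x B a) (chart_map x z) a = (act B (φ z) \o par_ x) a.
    apply: filterS2 (near_chart xz) (smooth_near_nbhs sT) => a [xa e] sa.
    rewrite /= /act (dir_chart _ xa) ?e//; exact: smooth_near_diff.
  have sAB := @smooth_near_along _ _ _ fE _ _ _ sB sT.
  have dB : differentiable (act B (φ z) \o par_ x) (φ x z).
    exact: smooth_near_diff (smooth_near_ext eB sAB).
  apply: etrans (dir_chart _ xz dB) _.
  rewrite -(near_eq_derive _ eB) (derive_along _ (smooth_near_diff sB) sT).
  by rewrite local_fieldK.
set B := 'D_(dir (X z) _) _ _ - _.
suff -> : bracket X Y z = cst_field x B z by exact: dir_cst_field.
apply: etrans (congr2 (fun u v => u - v) (key _ _ sX sY) (key _ _ sY sX)) _.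
rewrite (derive_comm _ _ sT) opprD addrACA subrr add0r.
by rewrite /cst_field (derive_dirB _ _ dT).
Qed.

End Atlas.

(** * The atlas of the slit tangent bundle *)

Section SlitAtlas.
Context {R : realType} {n : nat} (M : manifold R n).
Local Notation E := 'rV[R]_n.

Lemma manifold_overlap (x y z : M) :
  dom (chart_at x) z -> dom (chart_at y) z ->
  \forall a \near crd (chart_at x) z,
      [/\ dom (chart_at x) (par (chart_at x) a),
          dom (chart_at y) (par (chart_at x) a)
        & crd (chart_at x) (par (chart_at x) a) = a].
Proof.
move=> xz yz; set c := mchart x.
have oS : open (crd c @` dom c) := @mchart_open _ _ M x.
have Sz : (crd c @` dom c) (crd c z) by exists z.
have pz : par c (crd c z) = z := mchart_crdK xz.
have /(_ (crd c z) (mem_set Sz)) cp : {in crd c @` dom c, continuous (par c)}.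
  by rewrite -(continuous_open_subspace _ oS); exact: mchart_par_continuous.
have ny : nbhs (par c (crd c z)) (dom (mchart y)).
  by rewrite pz; apply: open_nbhs_nbhs; split => //; exact: (mchart_dom y).1.
have n1 : \forall a \near crd c z, dom (mchart y) (par c a) := cp _ ny.
have n2 : \forall a \near crd c z, (crd c @` dom c) a.
  exact: open_nbhs_nbhs.
apply: filterS2 n1 n2 => a ya [p xp e].
have pa : par c a = p by rewrite -e; exact: mchart_crdK.
by split => //; rewrite /= -/c pa.
Qed.

Lemma manifold_atlas : atlas M.
Proof.
split=> [x|x z|x y z|x y z xz yz].
- exact: (mchart_dom x).2.
- exact: mchart_crdK.
- exact: manifold_overlap.
exists (crd (mchart x) @` (dom (mchart x) `&` dom (mchart y))); split.
- rewrite openE => _ [p [xp yp] <-].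
  have := manifold_overlap xp yp; apply: filterS => a [xa ya e].
  by exists (par (mchart x) a).
- by exists z.
- exact: mchart_transition.
Qed.

Local Notation MA := manifold_atlas.

Lemma tangent_parE (x : M) (a : E * E) :
  dom (chart_at x) (par (chart_at x) a.1) ->
  crd (chart_at x) (par (chart_at x) a.1) = a.1 ->
  tangent_par (chart_at x) a.1 a.2 = cst_field x a.2 (par (chart_at x) a.1).
Proof. by move=> xa e; rewrite /tangent_par /cst_field e. Qed.

(** The default value of [insubd] is not reached: components in a chart determine
    a tangent vector, so the vector with components [a.2] is nonzero. *)
Lemma slit_par_neq0 (u : slit M) (a : E * E) : a.2 != 0 ->
  dom (chart_at (proj u)) (par (chart_at (proj u)) a.1) ->
  crd (chart_at (proj u)) (par (chart_at (proj u)) a.1) = a.1 ->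
  val (par (chart_at u) a) =
    (par (chart_at (proj u)) a.1, cst_field (proj u) a.2 (par (chart_at (proj u)) a.1)).
Proof.
move=> a0 xa e.
rewrite [LHS]val_insubd (_ : tangent_par _ _ _ = cst_field (proj u) a.2
  (par (chart_at (proj u)) a.1)) ?tangent_parE//=.
case: ifPn => // /negPn /eqP c0; move: a0.
by rewrite -(dir_cst_field MA a.2 xa) c0 /dir derive0 eqxx.
Qed.

Lemma slit_parK (u v : slit M) : dom (chart_at u) v ->
  par (chart_at u) (crd (chart_at u) v) = v.
Proof.
move=> uv; apply: val_inj.
have pv : par (chart_at (proj u)) (crd (chart_at (proj u)) (proj v)) = proj v.
  exact: atlas_parK MA _ _ uv.
rewrite [LHS]val_insubd /tangent_par /=.
rewrite -/(proj u) pv -/(chart_map (proj u) (proj v)) (dir_crdK MA _ uv).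
by rewrite -surjective_pairing (valP v).
Qed.

Lemma near_fst (a : E * E) (P : E -> Prop) :
  (\forall x \near a.1, P x) -> \forall b \near a, P b.1.
Proof.
by move=> h; have c : b.1 @[b --> a] --> a.1 by [exact: cvg_fst]; exact: (c _ h).
Qed.

Lemma near_neq0 (a : E * E) : a.2 != 0 -> \forall b \near a, b.2 != 0.
Proof.
move=> a0; have c : b.2 @[b --> a] --> a.2 by exact: cvg_snd.
exact: (cvgr_neq0 _ c a0).
Qed.

Lemma slit_overlap_val (u v : slit M) : dom (chart_at u) v ->
  \forall a \near crd (chart_at u) v,
    [/\ dom (chart_at (proj u)) (par (chart_at (proj u)) a.1),
        crd (chart_at (proj u)) (par (chart_at (proj u)) a.1) = a.1,
        a.2 != 0 &
      val (par (chart_at u) a) = (par (chart_at (proj u)) a.1,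
        cst_field (proj u) a.2 (par (chart_at (proj u)) a.1))].
Proof.
move=> uv.
have n0 : (crd (chart_at u) v).2 != 0.
  apply/negP => /eqP v0; have /negP := valP v; apply; apply/eqP.
  have := dir_crdK MA ((val v).2 : tangent (proj v)) uv.
  have {}v0 : dir ((val v).2 : tangent (proj v)) (crd (chart_at (proj u))) = 0 := v0.
  by rewrite v0 derive0.
have n1 : \forall a \near crd (chart_at u) v,
    dom (chart_at (proj u)) (par (chart_at (proj u)) a.1) /\
    crd (chart_at (proj u)) (par (chart_at (proj u)) a.1) = a.1.
  apply: (near_fst (P := fun x => dom (chart_at (proj u)) (par (chart_at (proj u)) x) /\
    crd (chart_at (proj u)) (par (chart_at (proj u)) x) = x)).
  exact: (near_chart MA uv).
apply: filterS2 n1 (near_neq0 n0) => a [ua e] a0; split => //.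
exact: slit_par_neq0.
Qed.

Lemma slit_crd_val (u q : slit M) (z : M) (w : E) : val q = (z, w) ->
  crd (chart_at u) q = (crd (chart_at (proj u)) z,
                        dir (w : tangent z) (crd (chart_at (proj u)))).
Proof. by case: q => -[x y] h e; case: e => <- <-. Qed.

Lemma slit_chart_map (u v p : slit M) : dom (chart_at u) p -> dom (chart_at v) p ->
  \forall a \near crd (chart_at u) p,
   chart_map u v a = (chart_map (proj u) (proj v) a.1, 'D_(a.2) (chart_map (proj u) (proj v)) a.1).
Proof.
move=> up vp.
have n3 : \forall a \near crd (chart_at u) p,
    dom (chart_at (proj v)) (par (chart_at (proj u)) a.1).
  apply: (near_fst (P := fun x => dom (chart_at (proj v)) (par (chart_at (proj u)) x))).
  by apply: filterS (manifold_overlap up vp) => a [].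
apply: filterS2 (slit_overlap_val up) n3 => a [ua e a0 ev] va.
apply: etrans (slit_crd_val v ev) _; apply/pair_equal_spec; split; first exact: erefl.
rewrite (dir_chart MA _ ua) ?e; first by rewrite (dir_cst_field MA _ ua).
have sT := atlas_smooth MA ua va; rewrite e in sT; exact: smooth_near_diff sT.
Qed.

(** The transition maps are the transition of [M] on positions and its derivative
    on velocities. *)
Lemma slit_atlas : atlas (slit M).
Proof.
split=> [u|u v|u v p up vp|u v p up vp].
- exact: (mchart_dom (proj u)).2.
- exact: slit_parK.
- have n3 : \forall a \near crd (chart_at u) p,
      dom (chart_at (proj v)) (par (chart_at (proj u)) a.1).
    apply: (near_fst (P := fun x => dom (chart_at (proj v)) (par (chart_at (proj u)) x))).
    by apply: filterS (manifold_overlap up vp) => a [].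
  apply: filterS2 (slit_overlap_val up) n3 => a [ua e a0 ev] va.
  have pa : proj (par (chart_at u) a) = par (chart_at (proj u)) a.1.
    by rewrite /proj /slit_proj ev.
  split; [by rewrite -pa in ua|by rewrite -pa in va|].
  by rewrite (slit_crd_val u ev) e (dir_cst_field MA _ ua) -surjective_pairing.
- have sT := atlas_smooth MA up vp.
  have sT1 : smooth_near (crd (chart_at u) p) (fun a : E * E => chart_map (proj u) (proj v) a.1).
    apply: smooth_near_comp => //; exact: smooth_near_fst (smooth_near_id _).
  have sX : smooth_near (crd (chart_at u) p) (fun a : E * E => (a.2, 0 : E)).
    apply: smooth_near_pair (smooth_near_cst _ _); exact: smooth_near_snd (smooth_near_id _).
  have n4 : \forall a \near crd (chart_at u) p, 'D_((a.2, 0) : E * E)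
      (fun b : E * E => chart_map (proj u) (proj v) b.1) a = 'D_(a.2) (chart_map (proj u) (proj v)) a.1.
    have n5 : \forall a \near crd (chart_at u) p,
        smooth_near a.1 (chart_map (proj u) (proj v)).
      apply: (near_fst (P := fun x => smooth_near x (chart_map (proj u) (proj v)))).
      exact: smooth_near_nbhs sT.
    apply: filterS n5 => a sa.
    exact: (@derive_comp_fst _ _ _ _ (chart_map (proj u) (proj v)) a (a.2, 0)
      (smooth_near_diff sa)).
  apply: smooth_near_ext (smooth_near_pair sT1 (smooth_near_along sX sT1)).
  by apply: filterS2 n4 (slit_chart_map up vp) => a -> ->.
Qed.

End SlitAtlas.

(** * Lifts and connections in an induced chart *)

Section LocalLifts.
Context {R : realType} {n : nat} {M : manifold R n}.
Local Notation E := 'rV[R]_n.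
Local Notation MA := (manifold_atlas M).
Local Notation SA := (slit_atlas M).
Local Notation φ u := (crd (chart_at u)).
Local Notation ψ u := (crd (chart_at (proj u))).
Implicit Types (u v : slit M).

(** The chart at [v] takes the curve that defines the lift to a straight line. *)
Lemma gamma_atE v (w : tangent (proj v)) : gamma_at w = (0, w) :> E * E.
Proof.
rewrite /gamma_at /velocity.
pose l (t : R) : E := (val v).2 + t *: (w : E).
have l0 : \forall t \near (0 : R), l t != 0.
  have c : l t @[t --> (0 : R)] --> l 0.
    exact: differentiable_continuous (differentiable_affine _ _ _).
  by apply: (cvgr_neq0 _ c); rewrite /l scale0r addr0; exact: (valP v).
have e : \forall t \near (0 : R), (φ v \o (fun t : R => insubd v ((val v).1, (val v).2 + t *: (w : E)))) t =
    (ψ v (proj v), (val v).2 + t *: (w : E)) :> E * E.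
  apply: filterS l0 => t lt.
  have ev : val (insubd v ((val v).1, (val v).2 + t *: (w : E))) = (proj v, l t).
    by rewrite val_insubd lt.
  apply: etrans (slit_crd_val v ev) _; congr pair.
  exact: (dir_crd MA).
rewrite (near_eq_derive _ e).
have dc : differentiable (fun=> ψ v (proj v) : E) (0 : R) by exact: differentiable_cst.
rewrite (derive_pair _ dc (differentiable_affine _ _ _)); congr pair.
  exact: derive_cst.
exact: derive_affine.
Qed.

Lemma rho_atE v (t : tangent v) : rho_at t = (t : E * E).1.
Proof.
have e : \forall a \near φ v v, ((ψ v \o proj) \o par (chart_at v)) a = a.1.
  apply: filterS (slit_overlap_val (atlas_dom SA v)) => a [va e _ ev].
  by rewrite /= /proj /slit_proj ev.
rewrite [LHS](near_eq_derive _ e).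
apply: etrans (derive_fst _ (smooth_near_diff (smooth_near_id _))) _.
by rewrite derive_id.
Qed.

Lemma dir_rho u v (t : tangent v) : dom (chart_at u) v ->
  dir (rho_at t) (ψ u) = (dir t (φ u)).1.
Proof.
move=> uv; rewrite rho_atE.
have sT := atlas_smooth SA (atlas_dom SA v) uv.
have sT0 := atlas_smooth MA (atlas_dom MA (proj v)) uv.
apply: esym; apply: etrans (esym (derive_fst t (smooth_near_diff sT))) _.
have e : \forall a \near φ v v, (chart_map v u a).1 = (chart_map (proj v) (proj u) \o fst) a.
  by apply: filterS (slit_chart_map (atlas_dom SA v) uv) => a ->.
rewrite (near_eq_derive _ e).
exact: (@derive_comp_fst _ _ _ _ (chart_map (proj v) (proj u)) (φ v v) t
  (smooth_near_diff sT0)).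
Qed.

(** The transition map is linear in the velocity, so its derivative along the fibre
    is itself. *)
Lemma dir_gamma u v (w : tangent (proj v)) : dom (chart_at u) v ->
  dir (gamma_at w) (φ u) = (0, dir w (ψ u)).
Proof.
move=> uv.
have sT := atlas_smooth SA (atlas_dom SA v) uv.
have sT0 := atlas_smooth MA (atlas_dom MA (proj v)) uv.
have dT0 := smooth_near_diff sT0.
rewrite [LHS]surjective_pairing; congr pair.
  by rewrite -dir_rho// rho_atE gamma_atE /= /dir derive0.
apply: etrans (esym (derive_snd _ (smooth_near_diff sT))) _.
have e : \forall a \near φ v v, (chart_map v u a).2 =
    (fun a : E * E => 'D_(a.2) (chart_map (proj v) (proj u)) a.1) a.
  by apply: filterS (slit_chart_map (atlas_dom SA v) uv) => a ->.
rewrite (near_eq_derive _ e) gamma_atE.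
apply/lim_near_cst => //=; near=> h.
have h0 : h != 0 by near: h; exact: nbhs_dnbhs_neq.
rewrite /= scaler0 add0r -/(ψ v _) (derive_dirD _ _ dT0) addrK (derive_dirZ _ _ dT0).
by rewrite scalerA mulVf// scale1r.
Unshelve. all: by end_near. Qed.

End LocalLifts.

Section LocalConnection.
Context {R : realType} {n : nat} {M : manifold R n}.
Local Notation E := 'rV[R]_n.
Local Notation MA := (manifold_atlas M).
Local Notation SA := (slit_atlas M).
Local Notation φ u := (crd (chart_at u)).
Local Notation ψ u := (crd (chart_at (proj u))).
Implicit Types (u v : slit M) (X Y : vfield (slit M)) (Z : pifield (M := M)).

Definition local_pifield u Z : E * E -> E :=
  fun a => dir (Z (par (chart_at u) a)) (ψ u).

Lemma local_pifieldK u v Z : dom (chart_at u) v ->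
  local_pifield u Z (φ u v) = dir (Z v) (ψ u).
Proof. by move=> uv; rewrite /local_pifield (atlas_parK SA uv). Qed.

Lemma slit_smooth_field u v X : dom (chart_at u) v -> vfield_smooth_at v X ->
  smooth_near (φ u v) (local_field u X).
Proof. exact (@smooth_local_field _ _ framed_pair _ SA u v X). Qed.

Lemma slit_bracket u v X Y : dom (chart_at u) v ->
  smooth_near (φ u v) (local_field u X) -> smooth_near (φ u v) (local_field u Y) ->
  dir (bracket X Y v) (φ u) =
  'D_(dir (X v) (φ u)) (local_field u Y) (φ u v) -
  'D_(dir (Y v) (φ u)) (local_field u X) (φ u v).
Proof. exact (@local_bracket _ _ framed_pair _ SA u v X Y). Qed.

Lemma local_rho u v X : dom (chart_at u) v ->
  \forall a \near φ u v, (local_field u X a).1 = local_pifield u (rho X) a.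
Proof.
by move=> uv; apply: filterS (near_chart SA uv) => a [ua _]; exact/esym/dir_rho.
Qed.

Lemma dir_J u v X : dom (chart_at u) v ->
  dir (J X v) (φ u) = (0, (dir (X v) (φ u)).1).
Proof. by move=> uv; rewrite [LHS]dir_gamma// dir_rho. Qed.

Lemma local_J u v X : dom (chart_at u) v ->
  \forall a \near φ u v, (0, (local_field u X a).1) = local_field u (J X) a.
Proof.
by move=> uv; apply: filterS (near_chart SA uv) => a [ua _]; exact/esym/dir_J.
Qed.

Lemma local_eta u v : dom (chart_at u) v ->
  \forall a \near φ u v, a.2 = local_pifield u eta a.
Proof.
move=> uv; apply: filterS (near_chart SA uv) => a [_ e].
exact: (congr1 snd (esym e)).
Qed.

(** The components change by the derivative of the transition map of [M]. *)
Lemma smooth_local_pifield u v Z : dom (chart_at u) v ->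
  pifield_smooth_at v Z -> smooth_near (φ u v) (local_pifield u Z).
Proof.
move=> uv sZ; have vv := atlas_dom SA v.
have sX := atlas_smooth SA uv vv.
have sT := atlas_smooth MA (atlas_dom MA (proj v)) uv.
have Ev := chart_map_crd SA v uv.
pose θ := chart_map (proj v) (proj u).
have sθ : smooth_near (φ v v) (fun c : E * E => θ c.1).
  apply: smooth_near_comp; last exact: sT.
  exact: smooth_near_fst (smooth_near_id _).
have sZ' : smooth_near (φ v v) (fun c : E * E => (local_pifield v Z c, 0 : E)).
  exact: smooth_near_pair sZ (smooth_near_cst _ _).
have sD : smooth_near (chart_map u v (φ u v))
    (fun c : E * E => 'D_((local_pifield v Z c, 0) : E * E) (fun c => θ c.1) c).
  by rewrite Ev; exact: smooth_near_along sZ' sθ.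
apply: smooth_near_ext (smooth_near_comp sX sD).
apply: filterS (atlas_overlap SA uv vv) => a [ua va e].
set p := par (chart_at u) a.
have sp : smooth_near (ψ v (proj p)) θ := atlas_smooth MA va ua.
apply: etrans (@derive_comp_fst _ _ _ _ θ (φ v p) _ (smooth_near_diff sp)) _.
apply: etrans (congr1 (fun w => 'D_w θ (ψ v (proj p))) (local_pifieldK Z va)) _.
exact: esym (dir_chart MA _ va (smooth_near_diff sp)).
Qed.

Definition cst_pifield v (w : E) : pifield := fun p => cst_field (proj v) w (proj p).

Lemma smooth_cst_pifield v w : pifield_smooth_at v (cst_pifield v w).
Proof.
suff : smooth_near (φ v v) (local_pifield v (cst_pifield v w)) by [].
apply: smooth_near_ext (smooth_near_cst _ w).
by apply: filterS (near_chart SA (atlas_dom SA v)) => a [va _]; exact/esym/(dir_cst_field MA).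
Qed.

Lemma cst_pifieldE v w : cst_pifield v w v = w.
Proof. exact: (cst_fieldE MA (proj v) w). Qed.

Lemma scale_N2K {W : lmodType R} (w : W) : - 2 *: (- 2^-1 *: w) = w.
Proof. by rewrite scalerA mulrN mulNr opprK divff ?pnatr_eq0// scale1r. Qed.

Lemma subr0_subr0 {W : zmodType} (w : W) : w - 0 - 0 = w.
Proof. by rewrite !subr0. Qed.

Lemma sub_cancel {W : zmodType} (w y z : W) : w - y - (z - y) = w - z.
Proof. by rewrite opprB addrA subrK. Qed.

Lemma half_sum {W : lmodType R} (w : W) : 2^-1 *: (w + w) = w.
Proof. by rewrite -mulr2n -(scaler_nat 2 w) scalerA mulVf ?pnatr_eq0// scale1r. Qed.

Lemma half_sub {W : lmodType R} (w z : W) : 2^-1 *: (z + (- 2 *: w - z)) = - w.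
Proof. by rewrite addrC subrK scalerA mulrN mulVf ?pnatr_eq0// scaleN1r. Qed.

Lemma half_opp_sub {W : lmodType R} (w z : W) : 2^-1 *: (z - (- 2 *: w - z)) = z + w.
Proof.
rewrite opprB scaleNr opprK addrA -mulr2n -(scaler_nat 2 z) -scalerDr.
by rewrite scalerA mulVf ?pnatr_eq0// scale1r.
Qed.

Section Spray.
Variable G : vfield (slit M).
Hypotheses (sG : vfield_smooth G) (rG : forall v, rho G v = eta v).

(** The spray has components [(y, - 2 F)]; with this sign and factor the
    Barthel connection has the coefficients [vd _ F]. *)
Definition spray_coef u : E * E -> E := fun a => - 2^-1 *: (local_field u G a).2.

Variables (u v : slit M) (uv : dom (chart_at u) v).
Local Notation a0 := (φ u v).
Local Notation F := (spray_coef u).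
Local Notation lf X := (local_field u X).

Lemma smooth_local_spray : smooth_near a0 (lf G).
Proof. exact: slit_smooth_field uv (sG v). Qed.

Lemma smooth_spray_coef : smooth_near a0 F.
Proof. exact/smooth_nearZ/smooth_near_snd/smooth_local_spray. Qed.

Lemma local_spray : \forall a \near a0, lf G a = (a.2, - 2 *: F a).
Proof.
have rGl : local_pifield u (rho G) = local_pifield u eta.
  by apply/funext => b; rewrite /local_pifield rG.
apply: filterS2 (local_rho G uv) (local_eta uv) => a; rewrite rGl => e1 e2.
rewrite [LHS]surjective_pairing; apply/pair_equal_spec; split; first by rewrite e1 e2.
exact/esym/scale_N2K.
Qed.

Lemma derive_local_spray c : 'D_c (lf G) a0 = (c.2, - 2 *: 'D_c F a0).
Proof.
have sF := smooth_spray_coef.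
rewrite (near_eq_derive _ local_spray).
have s2 : smooth_near a0 (fun a : E * E => a.2) := smooth_near_snd (smooth_near_id _).
have d2 := smooth_near_diff (smooth_nearZ (- 2) sF).
rewrite (derive_pair c (smooth_near_diff s2) d2); congr pair.
  by rewrite (derive_snd _ (smooth_near_diff (smooth_near_id _))) derive_id.
by rewrite [LHS]deriveZ//; exact: diff_derivable (smooth_near_diff sF).
Qed.

(** The derivatives of [X] cancel between the two brackets. *)
Lemma dir_barthel X : smooth_near a0 (lf X) ->
  dir (barthel G X v) (φ u) =
  ((dir (X v) (φ u)).1, - 2 *: vd (dir (X v) (φ u)).1 F a0 - (dir (X v) (φ u)).2).
Proof.
move=> sX; have sGl := smooth_local_spray.
have sJ : smooth_near a0 (lf (J X)).
  apply: smooth_near_ext (local_J X uv) _.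
  exact: vert_smooth (smooth_near_fst sX).
have dJX := dir_J X uv.
have e1 := slit_bracket uv sJ sGl; rewrite dJX in e1.
have e2 := slit_bracket uv sX sGl.
have e3 := dir_J (bracket X G) uv.
have e4 := dirB SA (bracket (J X) G v) (J (bracket X G) v) uv.
have e5 c : 'D_c (lf (J X)) a0 = (0, ('D_c (lf X) a0).1).
  apply: etrans (esym (near_eq_derive c (local_J X uv))) _.
  apply: etrans (derive_vert c (smooth_near_fst sX)) _.
  apply/pair_equal_spec; split; first exact: erefl.
  exact: (derive_fst c (smooth_near_diff sX)).
have e1' := etrans e1 (congr2 (fun x y => x - y) (derive_local_spray _) (e5 _)).
have e2' := etrans e2 (congr2 (fun x y => x - y) (derive_local_spray _) (erefl _)).
have e3' := etrans e3 (congr1 (fun t : E * E => (0, t.1)) e2').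
apply: etrans e4 _; apply: etrans (congr2 (fun x y => x - y) e1' e3') _.
apply/pair_equal_spec; split; first exact: subr0_subr0.
exact: sub_cancel.
Qed.

Lemma dir_hproj X : smooth_near a0 (lf X) ->
  dir (hproj G X v) (φ u) =
  ((dir (X v) (φ u)).1, - vd (dir (X v) (φ u)).1 F a0).
Proof.
move=> sX; apply: etrans (dirZ SA 2^-1 (X v + barthel G X v) uv) _.
apply: etrans (congr1 (fun t => 2^-1 *: t) (dirD SA (X v) (barthel G X v) uv)) _.
apply: etrans (congr1 (fun t => 2^-1 *: (_ + t)) (dir_barthel sX)) _.
by apply/pair_equal_spec; split; [exact: half_sum|exact: half_sub].
Qed.

Lemma dir_vproj X : smooth_near a0 (lf X) ->
  dir (vproj G X v) (φ u) =
  (0, (dir (X v) (φ u)).2 + vd (dir (X v) (φ u)).1 F a0).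
Proof.
move=> sX; apply: etrans (dirZ SA 2^-1 (X v - barthel G X v) uv) _.
apply: etrans (congr1 (fun t => 2^-1 *: t) (dirB SA (X v) (barthel G X v) uv)) _.
apply: etrans (congr1 (fun t => 2^-1 *: (_ - t)) (dir_barthel sX)) _.
apply/pair_equal_spec; split; last exact: half_opp_sub.
apply: etrans (scaler0 _ (2^-1 : R)); congr (_ *: _); exact: subrr.
Qed.

(** A vertical vector is the lift of exactly one vector, its second component. *)
Lemma dir_K X : smooth_near a0 (lf X) ->
  dir (K G X v) (ψ u) = (dir (X v) (φ u)).2 + vd (dir (X v) (φ u)).1 F a0.
Proof.
move=> sX; set k := RHS.
have : gamma_at (K G X v) = vproj G X v.
  apply: (@getPex _ [set w : tangent (proj v) | gamma_at w = vproj G X v]).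
  exists (cst_field (proj u) k (proj v)) => /=.
  apply: (dir_inj SA uv); rewrite dir_vproj// dir_gamma//.
  by rewrite (dir_cst_field MA).
move=> /(congr1 (fun t => dir t (φ u))); rewrite dir_vproj// dir_gamma//.
by case.
Qed.

(** A horizontal projection is determined by its first component.  Every first
    component occurs: project the field with constant components in the chart at
    [v]. *)
Lemma dir_beta Z : dir (beta G Z v) (φ u) =
  (dir (Z v) (ψ u), - vd (dir (Z v) (ψ u)) F a0).
Proof.
have hX X : vfield_smooth_at v X -> rho_at (hproj G X v) = Z v ->
    dir (hproj G X v) (φ u) = (dir (Z v) (ψ u), - vd (dir (Z v) (ψ u)) F a0).
  move=> /(slit_smooth_field uv) sX e; have dh := dir_hproj sX.
  have dr := dir_rho (hproj G X v) uv; rewrite e in dr.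
  have ez : dir (Z v) (ψ u) = (dir (X v) (φ u)).1 := etrans dr (congr1 fst dh).
  by move: ez; generalize (dir (Z v) (ψ u)) => z ->.
have [[X sX <-] e] : [set w : tangent v | im_hproj G w /\ rho_at w = Z v] (beta G Z v).
  apply: getPex; pose X := cst_field v ((Z v : E), (0 : E)).
  have sX : vfield_smooth_at v X := smooth_cst_field SA v _.
  have vv := atlas_dom SA v.
  exists (hproj G X v); split; first by exists X.
  apply: (dir_inj MA uv); apply: etrans (dir_rho _ uv) _.
  apply: etrans (congr1 fst (dir_hproj (slit_smooth_field uv sX))) _.
  have XE : X v = ((Z v : E), (0 : E)) := cst_fieldE SA v _.
  apply: etrans (esym (dir_rho _ uv)) _.
  have rX : rho_at (X v) = Z v := etrans (rho_atE (X v)) (congr1 fst XE).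
  by rewrite rX.
exact: hX.
Qed.

End Spray.
End LocalConnection.

(** * Coordinate representatives *)

Section Representation.
Context {R : realType} {n : nat} {M : manifold R n}.
Local Notation E := 'rV[R]_n.
Local Notation MA := (manifold_atlas M).
Local Notation SA := (slit_atlas M).
Local Notation φ u := (crd (chart_at u)).
Local Notation ψ u := (crd (chart_at (proj u))).
Implicit Types (u v p : slit M) (X Y : vfield (slit M)) (Z : pifield (M := M)).
Implicit Types (A B : E * E -> E * E) (x y z : E * E -> E).

(** The components of [X] in the chart at [u], up to equality near [v].  Fixing
    the germ only and not the function lets each operator be replaced by its formula
    in coordinates, also inside a derivative. *)
Definition field_rep u v X A : Prop :=
  smooth_near (φ u v) A /\ \forall a \near φ u v, A a = local_field u X a.

Definition pifield_rep u v Z z : Prop :=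
  smooth_near (φ u v) z /\ \forall a \near φ u v, z a = local_pifield u Z a.

Lemma field_rep_near u v X A : dom (chart_at u) v -> field_rep u v X A ->
  \forall a \near φ u v, field_rep u (par (chart_at u) a) X A.
Proof.
move=> uv [sA eA].
apply: filterS3 (near_chart SA uv) (smooth_near_nbhs sA) (nbhs_interior eA).
by move=> a [_ e] sa ea; split; rewrite e.
Qed.

Lemma pifield_rep_near u v Z z : dom (chart_at u) v -> pifield_rep u v Z z ->
  \forall a \near φ u v, pifield_rep u (par (chart_at u) a) Z z.
Proof.
move=> uv [sA eA].
apply: filterS3 (near_chart SA uv) (smooth_near_nbhs sA) (nbhs_interior eA).
by move=> a [_ e] sa ea; split; rewrite e.
Qed.

Lemma field_rep_val u v X A : dom (chart_at u) v -> field_rep u v X A ->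
  dir (X v) (φ u) = A (φ u v).
Proof.
by move=> uv [_ /nbhs_singleton]; rewrite (local_fieldK SA _ uv).
Qed.

Lemma pifield_rep_val u v Z z : dom (chart_at u) v -> pifield_rep u v Z z ->
  dir (Z v) (ψ u) = z (φ u v).
Proof. by move=> uv [_ /nbhs_singleton]; rewrite (local_pifieldK _ uv). Qed.

(** A formula for the components at single points gives a representative as soon
    as its hypotheses persist at nearby points. *)
Lemma field_rep_intro u v X A (P : slit M -> Prop) : dom (chart_at u) v ->
  (\forall a \near φ u v, P (par (chart_at u) a)) -> smooth_near (φ u v) A ->
  (forall p, dom (chart_at u) p -> P p -> dir (X p) (φ u) = A (φ u p)) ->
  field_rep u v X A.
Proof.
move=> uv nP sA h; split=> //; apply: filterS2 nP (near_chart SA uv) => a Pa [ua e].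
by rewrite /local_field (h _ ua Pa) e.
Qed.

Lemma pifield_rep_intro u v Z z (P : slit M -> Prop) : dom (chart_at u) v ->
  (\forall a \near φ u v, P (par (chart_at u) a)) -> smooth_near (φ u v) z ->
  (forall p, dom (chart_at u) p -> P p -> dir (Z p) (ψ u) = z (φ u p)) ->
  pifield_rep u v Z z.
Proof.
move=> uv nP sA h; split=> //; apply: filterS2 nP (near_chart SA uv) => a Pa [ua e].
by rewrite /local_pifield (h _ ua Pa) e.
Qed.

Lemma field_rep_smooth u v X A : field_rep u v X A -> smooth_near (φ u v) (local_field u X).
Proof. by move=> [sA eA]; exact: smooth_near_ext eA sA. Qed.

Lemma pifield_rep_local u v Z : dom (chart_at u) v -> pifield_smooth_at v Z ->
  pifield_rep u v Z (local_pifield u Z).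
Proof.
by move=> uv sZ; split; [exact: smooth_local_pifield|near=> a].
Unshelve. all: by end_near.
Qed.

Lemma dir_bracket_rep u v X Y A B : dom (chart_at u) v ->
  field_rep u v X A -> field_rep u v Y B ->
  dir (bracket X Y v) (φ u) = 'D_(A (φ u v)) B (φ u v) - 'D_(B (φ u v)) A (φ u v).
Proof.
move=> uv rX rY.
have h := slit_bracket uv (field_rep_smooth rX) (field_rep_smooth rY).
rewrite (field_rep_val uv rX) (field_rep_val uv rY) in h.
apply: etrans h (congr2 (fun s t => s - t) _ _).
- exact: esym (near_eq_derive _ rY.2).
- exact: esym (near_eq_derive _ rX.2).
Qed.

Lemma bracket_rep u v X Y A B : dom (chart_at u) v ->
  field_rep u v X A -> field_rep u v Y B ->
  field_rep u v (bracket X Y) (fun a => 'D_(A a) B a - 'D_(B a) A a).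
Proof.
move=> uv rX rY.
apply: (field_rep_intro (P := fun p => field_rep u p X A /\ field_rep u p Y B)) => //.
- exact (filterI (field_rep_near uv rX) (field_rep_near uv rY)).
- by apply: smooth_nearB; apply: smooth_near_along; [exact: rX.1|exact: rY.1|exact: rY.1|exact: rX.1].
- by move=> p up [pX pY]; exact: dir_bracket_rep.
Qed.

Lemma gamma_rep u v Z z : dom (chart_at u) v -> pifield_rep u v Z z ->
  field_rep u v (gamma Z) (fun a => (0, z a)).
Proof.
move=> uv rZ.
apply: (field_rep_intro (P := fun p => pifield_rep u p Z z)) => //.
- exact: pifield_rep_near.
- exact: vert_smooth rZ.1.
- move=> p up pZ; apply: etrans (dir_gamma _ up) _.
  by rewrite (pifield_rep_val up pZ).
Qed.

Lemma rho_rep u v X A : dom (chart_at u) v -> field_rep u v X A ->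
  pifield_rep u v (rho X) (fun a => (A a).1).
Proof.
move=> uv rX.
apply: (pifield_rep_intro (P := fun p => field_rep u p X A)) => //.
- exact: field_rep_near.
- exact: smooth_near_fst rX.1.
- move=> p up pX; apply: etrans (dir_rho _ up) _.
  by rewrite (field_rep_val up pX).
Qed.

Section Spray.
Variable G : vfield (slit M).
Hypotheses (sG : vfield_smooth G) (rG : forall v, rho G v = eta v).
Variable u : slit M.
Local Notation F := (spray_coef G u).

Lemma K_rep v X A : dom (chart_at u) v -> field_rep u v X A ->
  pifield_rep u v (K G X) (fun a => (A a).2 + vd (A a).1 F a).
Proof.
move=> uv rX; have sF := smooth_spray_coef sG uv.
apply: (pifield_rep_intro (P := fun p => field_rep u p X A)) => //.
- exact: field_rep_near.
- apply: smooth_nearD; first exact: smooth_near_snd rX.1.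
  by apply: smooth_vd_along => //; exact: smooth_near_fst rX.1.
- move=> p up pX; apply: etrans (dir_K sG rG up (field_rep_smooth pX)) _.
  by rewrite (field_rep_val up pX).
Qed.

Lemma beta_rep v Z z : dom (chart_at u) v -> pifield_rep u v Z z ->
  field_rep u v (beta G Z) (fun a => (z a, - vd (z a) F a)).
Proof.
move=> uv rZ; have sF := smooth_spray_coef sG uv.
apply: (field_rep_intro (P := fun p => pifield_rep u p Z z)) => //.
- exact: pifield_rep_near.
- apply: smooth_near_pair; first exact: rZ.1.
  by apply: smooth_nearN; apply: smooth_vd_along => //; exact: rZ.1.
- move=> p up pZ; apply: etrans (dir_beta sG rG up _) _.
  by rewrite (pifield_rep_val up pZ).
Qed.

End Spray.
End Representation.

Section BerwaldRepresentation.
Context {R : realType} {n : nat} {M : manifold R n}.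
Local Notation E := 'rV[R]_n.
Local Notation MA := (manifold_atlas M).
Local Notation SA := (slit_atlas M).
Local Notation φ u := (crd (chart_at u)).
Local Notation ψ u := (crd (chart_at (proj u))).
Implicit Types (u v p : slit M) (X Y : vfield (slit M)) (Z : pifield (M := M)).
Implicit Types (A B : E * E -> E * E) (x y z : E * E -> E).

Lemma pifield_rep_ext u v Z z z' : (\forall a \near φ u v, z a = z' a) ->
  pifield_rep u v Z z -> pifield_rep u v Z z'.
Proof.
move=> e [sz ez]; split; first exact: smooth_near_ext e sz.
by apply: filterS2 e ez => a ea ez; rewrite -ea.
Qed.

Lemma pifield_rep_add u v Z Z' z z' : dom (chart_at u) v ->
  pifield_rep u v Z z -> pifield_rep u v Z' z' ->
  pifield_rep u v (fun p => Z p + Z' p) (fun a => z a + z' a).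
Proof.
move=> uv [sz ez] [sz' ez']; split; first exact: smooth_nearD.
apply: filterS3 ez ez' (near_chart SA uv) => a ea ea' [ua _].
by rewrite ea ea'; exact: esym (dirD MA _ _ ua).
Qed.

Lemma pifield_rep_opp u v Z z : dom (chart_at u) v ->
  pifield_rep u v Z z -> pifield_rep u v (fun p => - Z p) (fun a => - z a).
Proof.
move=> uv [sz ez]; split; first exact: smooth_nearN.
apply: filterS2 ez (near_chart SA uv) => a ea [ua _].
by rewrite ea; exact: esym (dirN MA _ ua).
Qed.

Section Spray.
Variable G : vfield (slit M).
Hypotheses (sG : vfield_smooth G) (rG : forall v, rho G v = eta v).
Variable u : slit M.
Local Notation F := (spray_coef G u).

Lemma berwald_rep v X (Y : pifield) A y : dom (chart_at u) v ->
  field_rep u v X A -> pifield_rep u v Y y ->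
  pifield_rep u v (berwald G X Y)
    (fun a => 'D_(A a) y a + vd (y a) (vd (A a).1 F) a).
Proof.
move=> uv rX rY.
have r1 := rho_rep uv (bracket_rep uv (gamma_rep uv (K_rep sG rG uv rX)) (beta_rep sG rG uv rY)).
have r2 := K_rep sG rG uv (bracket_rep uv (beta_rep sG rG uv (rho_rep uv rX)) (gamma_rep uv rY)).
apply: pifield_rep_ext (pifield_rep_add uv r1 r2).
apply: filterS3 (smooth_near_nbhs (smooth_spray_coef sG uv)) (smooth_near_nbhs rX.1)
  (smooth_near_nbhs rY.1) => a sF sA sy.
exact: (berwald_calc sF sA sy).
Qed.

Lemma berwald_gamma_rep v (X Y : pifield) x y : dom (chart_at u) v ->
  pifield_rep u v X x -> pifield_rep u v Y y ->
  pifield_rep u v (berwald G (gamma X) Y) (fun a => vd (x a) y a).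
Proof.
move=> uv rX rY; apply: pifield_rep_ext (berwald_rep uv (gamma_rep uv rX) rY).
by near=> a; rewrite vd_vd0 addr0.
Unshelve. all: by end_near. Qed.

(** In coordinates the hv-curvature is the third derivative along the fibre of the
    spray coefficients. *)
Lemma dir_hv_curvature v (X Y Z : pifield) x y z : dom (chart_at u) v ->
  pifield_rep u v X x -> pifield_rep u v Y y -> pifield_rep u v Z z ->
  dir (hv_curvature G X Y Z v) (ψ u) =
  vd (y (φ u v)) (vd (z (φ u v)) (vd (x (φ u v)) F)) (φ u v).
Proof.
move=> uv rX rY rZ; set a := φ u v.
have rB := beta_rep sG rG uv rX; have rD := gamma_rep uv rY.
have r1 := berwald_rep uv rB (berwald_gamma_rep uv rY rZ).
have r2 := berwald_gamma_rep uv rY (berwald_rep uv rB rZ).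
have r3 := berwald_rep uv (bracket_rep uv rB rD) rZ.
have rC := pifield_rep_add uv (pifield_rep_add uv (pifield_rep_opp uv r1) r2) r3.
apply: etrans (pifield_rep_val uv rC) _.
exact: (curvature_calc (smooth_spray_coef sG uv) rX.1 rY.1 rZ.1).
Qed.

End Spray.
End BerwaldRepresentation.

(** * The Douglas tensor in coordinates *)

Section LocalTrace.
Context {R : realType} {n : nat} {M : manifold R n}.
Local Notation E := 'rV[R]_n.
Local Notation MA := (manifold_atlas M).
Local Notation SA := (slit_atlas M).
Local Notation φ u := (crd (chart_at u)).
Local Notation ψ u := (crd (chart_at (proj u))).
Variable G : vfield (slit M).
Hypotheses (sG : vfield_smooth G) (rG : forall v, rho G v = eta v).
Variable u : slit M.
Local Notation F := (spray_coef G u).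

(** The trace is defined in the preferred chart at [v] and computed in the chart at
    [u]; the two matrices are conjugate.  The matrix in [pitrace] is unique because
    fields with constant components take every value at [v]. *)
Lemma hv_traceE v (X Y : pifield) x y : dom (chart_at u) v ->
  pifield_rep u v X x -> pifield_rep u v Y y ->
  hv_trace G X Y v = vd (y (φ u v)) (vd (x (φ u v)) (vdiv F)) (φ u v).
Proof.
move=> uv rX rY; set a := φ u v.
have sF : smooth_near a F := smooth_spray_coef sG uv.
pose T (w : E) := vd (y a) (vd w (vd (x a) F)) a.
pose g (t : E) : E := cst_field (proj u) t (proj v).
pose h (w : E) : E := dir (w : tangent (proj v)) (ψ u).
have curvE (Z : pifield) : pifield_smooth_at v Z ->
    hv_curvature G X Y Z v = g (T (h (Z v))).
  move=> sZ; have rZ := pifield_rep_local uv sZ.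
  have d1 : dir (hv_curvature G X Y Z v) (ψ u) = T (h (Z v)).
    exact (etrans (dir_hv_curvature sG rG uv rX rY rZ)
      (congr1 (fun w => vd (y a) (vd w (vd (x a) F)) a) (esym (pifield_rep_val uv rZ)))).
  exact (etrans (esym (dir_crdK MA _ uv)) (congr1 g d1)).
have lT : linear T by exact: vd2_linear (smooth_near_vd _ sF).
have lg : linear g.
  move=> k w w'; have dT := smooth_near_diff (atlas_smooth MA uv (atlas_dom MA (proj v))).
  by apply: etrans (derive_dirD _ _ dT) _; congr (_ + _); exact: derive_dirZ.
have lh : linear h.
  move=> k w w'; apply: etrans (dirD MA _ _ uv) _.
  exact (congr1 (fun t => t + h w') (dirZ MA k (w : tangent (proj v)) uv)).
have hg w : h (g w) = w by exact (dir_cst_field MA w uv).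
have mulB w : w *m mx_of (fun w => g (T (h w))) = g (T (h w)).
  apply: mul_mx_of => k w1 w2.
  by rewrite lh lT lg.
pose S := [set B : 'M[R]_n | forall Z : pifield,
  pifield_smooth_at v Z -> (Z v : 'rV[R]_n) *m B = hv_curvature G X Y Z v].
have SB : S (mx_of (fun w => g (T (h w)))).
  by move=> Z sZ; exact (etrans (mulB (Z v)) (esym (curvE Z sZ))).
have getB : S (get S) := getPex (ex_intro S _ SB).
have eB : get S = mx_of (fun w => g (T (h w))).
  apply: eq_mx_of => w; have sw := smooth_cst_pifield v w.
  have hw := etrans (getB _ sw) (curvE _ sw).
  by rewrite cst_pifieldE in hw.
rewrite /hv_trace /pitrace -/S eB (tr_mx_of_conj lT lg lh hg).
apply: etrans (esym (vd2_vdiv _ _ sF)).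
by apply: eq_bigr => i _; rewrite mxE.
Qed.

End LocalTrace.

Section LocalDouglas.
Context {R : realType} {n : nat} {M : manifold R n}.
Local Notation E := 'rV[R]_n.
Local Notation MA := (manifold_atlas M).
Local Notation SA := (slit_atlas M).
Local Notation φ u := (crd (chart_at u)).
Local Notation ψ u := (crd (chart_at (proj u))).
Variable G : vfield (slit M).
Hypotheses (sG : vfield_smooth G) (rG : forall v, rho G v = eta v).
Variable u : slit M.
Local Notation F := (spray_coef G u).
Local Notation a := (φ u u).
Let uu : dom (chart_at u) u := atlas_dom SA u.

Lemma hv_trace_near (X Z : pifield) x z : pifield_rep u u X x -> pifield_rep u u Z z ->
  \forall b \near a, vd (z b) (vd (x b) (vdiv F)) b = (hv_trace G X Z \o par (chart_at u)) b.
Proof.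
move=> rX rZ.
apply: filterS3 (near_chart SA uu) (pifield_rep_near uu rX) (pifield_rep_near uu rZ).
move=> b [ub e] bX bZ.
by have := hv_traceE sG rG ub bX bZ; rewrite e => /esym.
Qed.

(** The derivatives of the arguments in the Leibniz rule are the corrections by
    Berwald derivatives, which have no connection term along the fibre. *)
Lemma D_hv_traceE (X Y Z : pifield) x y z :
  pifield_rep u u X x -> pifield_rep u u Y y -> pifield_rep u u Z z ->
  D_hv_trace G (gamma Y) X Z u = vd (y a) (vd (z a) (vd (x a) (vdiv F))) a.
Proof.
move=> rX rY rZ.
have sS := smooth_vdiv (smooth_spray_coef sG uu).
have gY : gamma Y u = (0, y a) :> E * E.
  apply: etrans (gamma_atE _) _; congr pair.
  exact (etrans (esym (dir_crd MA (Y u))) (pifield_rep_val uu rY)).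
have e1 : act (gamma Y) (hv_trace G X Z) u =
    'D_((0, y a) : E * E) (fun b => vd (z b) (vd (x b) (vdiv F)) b) a.
  rewrite /act gY.
  exact: esym (near_eq_derive _ (hv_trace_near rX rZ)).
have e2 := hv_traceE sG rG uu (berwald_gamma_rep sG rG uu rY rX) rZ.
have e3 := hv_traceE sG rG uu rX (berwald_gamma_rep sG rG uu rY rZ).
have e4 := derive_vd_along2 (0, y a) rX.1 rZ.1 sS.
rewrite /D_hv_trace e1 e2 e3 e4.
exact: (etrans (congr1 (fun t => t - _) (addrK _ _)) (addrK _ _)).
Qed.

Lemma douglasE (X Y Z : pifield) :
  pifield_smooth_at u X -> pifield_smooth_at u Y -> pifield_smooth_at u Z ->
  douglas G X Y Z u = local_douglas F a (X u) (Y u) (Z u).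
Proof.
move=> sX sY sZ.
have rep W := @pifield_rep_local _ _ _ u u W uu.
have val (W : pifield) : local_pifield u W a = W u.
  exact (etrans (local_pifieldK W uu) (dir_crd MA (W u))).
have rX := rep X sX; have rY := rep Y sY; have rZ := rep Z sZ.
have etaE : eta u = a.2 :> E by exact (esym (dir_crd MA (eta u))).
have eP : hv_curvature G X Y Z u = vd (Y u) (vd (Z u) (vd (X u) F)) a.
  have := dir_hv_curvature sG rG uu rX rY rZ; rewrite !val => <-.
  exact: esym (dir_crd MA _).
have eT W W' : pifield_smooth_at u W -> pifield_smooth_at u W' ->
    hv_trace G W W' u = vd (W' u) (vd (W u) (vdiv F)) a.
  by move=> sW sW'; have := hv_traceE sG rG uu (rep W sW) (rep W' sW'); rewrite !val.
have eD := D_hv_traceE rX rY rZ; rewrite !val in eD.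
by rewrite /douglas eP (eT X Y) // (eT Y Z)// (eT Z X)// eD etaE.
Qed.

End LocalDouglas.

(** * The canonical spray *)

Section CanonicalSpray.
Context {R : realType} {n : nat} {M : manifold R n}.
Local Notation E := 'rV[R]_n.
Local Notation MA := (manifold_atlas M).
Local Notation SA := (slit_atlas M).
Local Notation φ u := (crd (chart_at u)).
Local Notation ψ u := (crd (chart_at (proj u))).

(** Homogeneity passes to coordinates because [par] is linear on the velocities. *)
Lemma near_homogeneous (f : TM M -> R) (u v : slit M) : pos_homogeneous1 f ->
  dom (chart_at u) v ->
  \forall b \near φ u v, vd b.2 (fun b => f (val (par (chart_at u) b))) b =
    f (val (par (chart_at u) b)).
Proof.
move=> fh uv; apply: filterS (slit_overlap_val uv) => b [ub e b0 ev].
apply: (vd_homogeneous1 (f := fun b => f (val (par (chart_at u) b)))) => t t0.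
have tb0 : (b.1, t *: b.2).2 != 0 by rewrite /= scaler_eq0 negb_or gt_eqF.
have evt := slit_par_neq0 (u := u) (a := (b.1, t *: b.2)) tb0 ub e.
set q := par (chart_at (proj u)) b.1.
have dT := smooth_near_diff (atlas_smooth MA ub (atlas_dom MA q)).
have e2 := congr1 (fun w => f (q, w)) (derive_dirZ t b.2 dT).
exact (etrans (congr1 f evt) (etrans e2
  (etrans (fh q _ t t0) (congr1 (fun s => t * f s) (esym ev))))).
Qed.

Lemma addr_double_inj (p q : R) : p + q = 2 *: q -> p = q.
Proof. by rewrite scaler_nat mulr2n => /addIr. Qed.

Lemma ext_cancel (p q s t : R) : p + s - (q + t) - (s - t) = p - q.
Proof. ring. Qed.

Lemma vd_dirB {W : normedModType R} (f : E * E -> W) b s t : smooth_near b f ->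
  vd (s - t) f b = vd s f b - vd t f b.
Proof.
move=> sf; have e : (0, s - t) = (0, s) - (0, t) :> E * E.
  by apply/pair_equal_spec; split => //; exact: esym (subr0 _).
by rewrite /vd e; exact: derive_dirB (smooth_near_diff sf).
Qed.

Lemma sub0r_oppr_inj (p q : R) : 0 - p = - q -> p = q.
Proof. by rewrite sub0r => /oppr_inj. Qed.

Lemma projective_coef (g y : E) (l : R) :
  - 2^-1 *: (g - (2 * l) *: y) = - 2^-1 *: g + l *: y.
Proof.
have -> : - 2^-1 *: (g - (2 * l) *: y) = - 2^-1 *: g - - 2^-1 *: ((2 * l) *: y).
  by rewrite scalerBr.
have -> : - 2^-1 *: ((2 * l) *: y) = - (l *: y).
  by rewrite scalerA mulNr mulrA mulVf ?pnatr_eq0// mul1r scaleNr.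
by rewrite opprK.
Qed.

Lemma derive_vd0 {W : normedModType R} (f : E * E -> W) b c : 'D_c (vd 0 f) b = 0.
Proof.
have -> : vd 0 f = fun=> 0 :> W by apply/funext => d; exact: vd0.
exact: derive_cst.
Qed.

Lemma vd_comm_scalar (f : E * E -> R) b s t : smooth_near b f ->
  vd s (vd t f) b = vd t (vd s f) b.
Proof. by move=> sf; exact (derive_comm_scalar (0, t) (0, s) sf). Qed.

Lemma vd_vd_dirB (f : E * E -> R) b w s t : smooth_near b f ->
  vd w (vd (s - t) f) b = vd w (vd s f) b - vd w (vd t f) b.
Proof.
move=> sf; have h := vd_dirB s t (smooth_near_vd w sf).
exact (etrans (vd_comm_scalar w (s - t) sf) (etrans h (congr2 (fun p q => p - q)
  (vd_comm_scalar s w sf) (vd_comm_scalar t w sf)))).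
Qed.

Section Energy.
Variables (L : TM M -> R) (hL : finsler L) (u : slit M).
Local Notation a := (φ u u).
Let uu : dom (chart_at u) u := atlas_dom SA u.
Let e (b : E * E) : R := energy L (par (chart_at u) b).

Lemma smooth_energy v : dom (chart_at u) v -> smooth_near (φ u v) e.
Proof.
move=> uv; have sL : smooth_near (φ u v) (fun b => L (val (par (chart_at u) b))).
  exact (smooth_at_chart SA uv (finsler_smooth hL v)).
apply: smooth_near_ext (smooth_nearZ 2^-1 (smooth_near_scale sL sL)).
by near=> b; rewrite /e /energy expr2.
Unshelve. all: by end_near. Qed.

(** The energy [e] is homogeneous of degree 2, so [vd y e = 2 e] near [a]; this is
    the derivative of that identity along the fibre. *)
Lemma vd2_energy w : vd w (vd a.2 e) a = vd w e a.
Proof.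
have sL : smooth_near a (fun b => L (val (par (chart_at u) b))) := finsler_smooth hL u.
have se := smooth_energy uu.
have eul : \forall b \near a, vd b.2 e b = 2 *: e b.
  apply: filterS2 (smooth_near_nbhs sL) (near_homogeneous (finsler_homogeneous hL) uu) => b bL bh.
  pose l := fun b => L (val (par (chart_at u) b)).
  have -> : e = fun b => 2^-1 *: (l b *: l b).
    by apply/funext => c; rewrite /e /energy expr2.
  apply: etrans (vdZ b.2 2^-1 (smooth_near_scale bL bL)) _.
  apply: etrans (congr1 (fun t => 2^-1 *: t) (vd_scale b.2 bL bL)) _.
  rewrite -/l in bh; rewrite bh.
  by rewrite half_sum scalerA divff ?pnatr_eq0// scale1r.
have h1 := derive_vd_along (0, w) (smooth_snd a) se.
have h2 := near_eq_derive (0, w) eul.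
have h3 : 'D_((0, w) : E * E) (fun b => 2 *: e b) a = 2 *: vd w e a := vdZ w 2 se.
have h4 : vd ('D_((0, w) : E * E) (fun b : E * E => b.2) a) e a = vd w e a.
  exact (congr1 (fun t => vd t e a) (vd_snd a w)).
have h : vd w (vd a.2 e) a + vd w e a = 2 *: vd w e a.
  exact (etrans (congr1 (fun t => _ + t) (esym h4)) (etrans (esym h1) (etrans h2 h3))).
exact (addr_double_inj h).
Qed.

Lemma near_d_J X A : field_rep u u X A ->
  \forall b \near a, vd (A b).1 e b = (d_J (energy L) X \o par (chart_at u)) b.
Proof.
move=> rX; apply: filterS2 (near_chart SA uu) (field_rep_near uu rX) => b [ub eb] bX.
have de := smooth_near_diff (smooth_energy ub).
apply: esym; apply: etrans (dir_chart SA _ ub de) _.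
rewrite eb (dir_J _ ub) (field_rep_val ub bX) eb //.
Qed.

Lemma rep_at_base X A : field_rep u u X A -> X u = A a :> E * E.
Proof. by move=> rX; rewrite -(field_rep_val uu rX) (dir_crd SA). Qed.

(** The derivatives of the fields cancel in the exterior derivative, as it is a
    tensor. *)
Lemma ext_dJ_energy X Y A B : field_rep u u X A -> field_rep u u Y B ->
  ext_d (d_J (energy L)) X Y u =
  'D_(A a) (vd (B a).1 e) a - 'D_(B a) (vd (A a).1 e) a.
Proof.
move=> rX rY; have se := smooth_energy uu.
have e1 : act X (d_J (energy L) Y) u = 'D_(A a) (fun b => vd (B b).1 e b) a.
  rewrite /act /dir (rep_at_base rX).
  exact: esym (near_eq_derive _ (near_d_J rY)).
have e2 : act Y (d_J (energy L) X) u = 'D_(B a) (fun b => vd (A b).1 e b) a.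
  rewrite /act /dir (rep_at_base rY).
  exact: esym (near_eq_derive _ (near_d_J rX)).
have sA1 : smooth_near a (fun b => (A b).1) := smooth_near_fst rX.1.
have sB1 : smooth_near a (fun b => (B b).1) := smooth_near_fst rY.1.
have e3 : d_J (energy L) (bracket X Y) u =
    vd ('D_(A a) (fun b => (B b).1) a) e a - vd ('D_(B a) (fun b => (A b).1) a) e a.
  have h := etrans (nbhs_singleton (near_d_J (bracket_rep uu rX rY)))
    (congr1 (d_J (energy L) (bracket X Y)) (atlas_parK SA uu)).
  have d1 := derive_fst (A a) (smooth_near_diff rY.1).
  have d2 := derive_fst (B a) (smooth_near_diff rX.1).
  exact (etrans (esym h) (etrans (esym (congr2 (fun s t => vd (s - t) e a) d1 d2))
    (vd_dirB _ _ se))).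
have f1 := etrans e1 (derive_vd_along (A a) sB1 se).
have f2 := etrans e2 (derive_vd_along (B a) sA1 se).
exact (etrans (congr2 (fun s t => s - t) (congr2 (fun s t => s - t) f1 f2) e3)
  (ext_cancel _ _ _ _)).
Qed.

End Energy.

(** Let [V] be the difference of rho G and eta in coordinates.  On vertical fields
    the equation of the spray becomes [vd w (vd V e) = 0] for all [w], by Euler's
    identity for the energy.  Hence the vertical lift of [V] is in the kernel of
    dd_J E, which is trivial. *)
Lemma canonical_spray_rho (L : TM M -> R) (G : vfield (slit M)) :
  finsler L -> canonical_spray L G -> forall u, rho G u = eta u.
Proof.
move=> hL [sG hG] u; set a := φ u u.
have uu : dom (chart_at u) u := atlas_dom SA u.
pose e (b : E * E) : R := energy L (par (chart_at u) b).
have se : smooth_near a e := smooth_energy hL uu.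
have rG : field_rep u u G (local_field u G).
  by split; [exact: slit_smooth_field uu (sG u)|near=> b].
pose V : E := (local_field u G a).1 - a.2.
have rep_cst w : field_rep u u (gamma (cst_pifield u w)) (fun b => (0, local_pifield u (cst_pifield u w) b)).
  exact: gamma_rep uu (pifield_rep_local uu (smooth_cst_pifield u w)).
have cstE w : local_pifield u (cst_pifield u w) a = w.
  exact (etrans (local_pifieldK _ uu) (etrans (dir_crd MA _) (cst_pifieldE u w))).
have vertV w : vd w (vd V e) a = 0.
  have sY : vfield_smooth_at u (gamma (cst_pifield u w)) := field_rep_smooth (rep_cst w).
  have h := hG u _ sY.
  have h1 := ext_dJ_energy hL rG (rep_cst w).
  have Yu : gamma (cst_pifield u w) u = (0, w) :> E * E.
    exact (etrans (rep_at_base (rep_cst w)) (congr1 (pair 0) (cstE w))).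
  have h2 : act (gamma (cst_pifield u w)) (energy L) u = vd w e a.
    exact (congr1 (fun c : E * E => 'D_c e a) Yu).
  have h3 : ext_d (d_J (energy L)) G (gamma (cst_pifield u w)) u =
      0 - vd w (vd (local_field u G a).1 e) a.
    exact (etrans h1 (congr2 (fun p q => p - q) (derive_vd0 _ _ _)
      (congr1 (fun t => 'D_((0, t) : E * E) (vd (local_field u G a).1 e) a) (cstE w)))).
  have h4 := etrans (esym h3) (etrans h (congr1 (fun t => - t) h2)).
  have h5 := etrans (sub0r_oppr_inj h4) (esym (vd2_energy hL u w)).
  exact (etrans (vd_vd_dirB w _ _ se) (etrans (congr1 (fun t => t - _) h5) (subrr _))).
have XV : gamma (cst_pifield u V) u = 0.
  apply: (finsler_nondegenerate hL); first exact: field_rep_smooth (rep_cst V).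
  move=> Y sY; have rY : field_rep u u Y (local_field u Y).
    by split; [exact: slit_smooth_field uu sY|near=> b].
  apply: etrans (ext_dJ_energy hL (rep_cst V) rY) _.
  have h1 := congr2 (fun p q => p - q)
    (congr1 (fun t => 'D_((0, t) : E * E) (vd (local_field u Y a).1 e) a) (cstE V))
    (derive_vd0 e a (local_field u Y a)).
  apply: etrans h1 _; apply: etrans (subr0 _) _.
  exact (etrans (vd_comm_scalar _ _ se) (vertV _)).
have V0 : V = 0.
  have h := etrans (esym (rep_at_base (rep_cst V))) XV.
  exact (etrans (esym (cstE V)) (congr1 snd h)).
have GV : (local_field u G a).1 = a.2 by exact (subr0_eq V0).
have etaE : eta u = a.2 :> E by exact (esym (dir_crd MA (eta u))).
exact (etrans (rho_atE (G u)) (etrans (congr1 fst (rep_at_base rG)) (etrans GV (esym etaE)))).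
Unshelve. all: by end_near. Qed.

Section ProjectiveChange.
Variables (lambda : TM M -> R) (G G' : vfield (slit M)).
Hypothesis rG : forall v, rho G v = eta v.
Hypothesis projective : forall u : slit M,
  G' u = G u - (2 * lambda (val u)) *: Liouville u.

(** The Liouville field has components [(0, y)]. *)
Lemma spray_coef_projective u : \forall b \near φ u u,
  spray_coef G' u b = spray_coef G u b + lambda (val (par (chart_at u) b)) *: b.2.
Proof.
have uu : dom (chart_at u) u := atlas_dom SA u.
apply: filterS2 (near_chart SA uu) (local_eta uu) => b [ub e] eb.
set p := par (chart_at u) b.
have h1 : local_field u G' b = local_field u G b -
    (2 * lambda (val p)) *: (0, local_pifield u eta b).
  apply: etrans (congr1 (fun t => dir t (φ u)) (projective p)) _.
  apply: etrans (dirB SA _ _ ub) _.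
  apply: congr1; apply: congr1; apply: etrans (dirZ SA _ _ ub) _.
  by apply: congr1; exact: dir_gamma.
rewrite -eb in h1.
have h2 := congr1 snd h1.
exact (etrans (congr1 (fun t => - 2^-1 *: t) h2) (projective_coef _ _ _)).
Qed.

End ProjectiveChange.

End CanonicalSpray.

Theorem theorem4p5 (R : realType) (n : nat) (M : manifold R n)
    (L L' : TM M -> R) (hL : finsler L) (hL' : finsler L')
    (G G' : vfield (slit M))
    (hG : canonical_spray L G) (hG' : canonical_spray L' G')
    (lambda : TM M -> R)
    (lambda_smooth : smooth (slit M) (fun u => lambda (val u)))
    (lambda_hom : pos_homogeneous1 lambda)
    (projective : forall u : slit M,
       G' u = G u - (2 * lambda (val u)) *: Liouville u)
    (X Y Z : pifield (M := M))
    (hX : pifield_smooth X) (hY : pifield_smooth Y) (hZ : pifield_smooth Z) :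
  forall u : slit M, douglas G' X Y Z u = douglas G X Y Z u.
Proof.
move=> u; have rG := canonical_spray_rho hL hG.
have rG' := canonical_spray_rho hL' hG'.
have uu := atlas_dom (slit_atlas M) u.
apply: etrans (douglasE hG'.1 rG' (hX u) (hY u) (hZ u)) _.
apply: etrans (esym (douglasE hG.1 rG (hX u) (hY u) (hZ u))).
exact (local_douglas_projective (smooth_spray_coef hG.1 uu) (lambda_smooth u)
  (spray_coef_projective projective u) (near_homogeneous lambda_hom uu) _ _ _).
Qed.
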